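(* Let $k=\mathbb{F}_q$ be a finite field, let $N\ge 1$ be an integer, and let $\Gamma=\mathrm{PGL}_{N+1}(k)$. With the set $\mathcal{S}$ of subtypes, the weighted posets $\mathcal{L}(\alpha)$, the coefficients $M_\alpha$, and the power series $f_{V^0}$, $\overline{f}_{V^0}$ defined in the context, the following identities of formal power series hold: $$\sum_{n\ge0}t_N(n)x^n=\sum_{\alpha\in\mathcal{S}}M_{\alpha}\prod_{V\in\mathcal{L}(\alpha)}f_{V^0}\bigl(x^{\exp(V)\deg(V)}\bigr),$$ $$\sum_{n\ge0}\overline{t}_N(n)x^n=\sum_{\alpha\in\mathcal{S}}M_{\alpha}\prod_{V\in\mathcal{L}(\alpha)}\overline{f}_{V^0}\bigl(x^{\exp(V)\deg(V)}\bigr).$$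
   Context: Let $k=\mathbb{F}_q$, let $\bar k$ be an algebraic closure, $k_r=\mathbb{F}_{q^r}\subset\bar k$, and let $\sigma$ be the $q$-Frobenius $x\mapsto x^q$, acting coordinatewise on $\mathbb{P}^N(\bar k)$. A rational $n$-set (resp. $n$-multiset) of $\mathbb{P}^N$ is an $n$-element subset (resp. a multiset of cardinality $n$) of $\mathbb{P}^N(\bar k)$ that is stable under $\sigma$. The number $t_N(n)$ (resp. $\overline{t}_N(n)$) is the number of orbits of $\Gamma=\mathrm{PGL}_{N+1}(k)$ acting on the set of rational $n$-sets (resp. rational $n$-multisets) of $\mathbb{P}^N$; in particular $t_N(0)=\overline t_N(0)=1$. Let $\gamma\in\Gamma$. Let $\mathcal{L}_\gamma$ be the poset, ordered by inclusion, of the (nonempty) $\gamma$-invariant irreducible linear subvarieties of $\mathbb{P}^N(\bar k)$. For $V\in\mathcal{L}_\gamma$, $\exp V$ is the order of $\gamma_{|V}$ as a projective automorphism of $V$. Such a $V$ is called proper if $\exp V<\exp W$ for every $W\in\mathcal{L}_\gamma$ with $V\subsetneq W$. Let $\mathcal{L}_\gamma^{\mathrm{pr}}$ be the (finite) subposet of proper elements. The Frobenius $\sigma$ acts on $\mathcal{L}_\gamma^{\mathrm{pr}}$. The degree $\deg V$ is the minimal $r\ge 1$ with $\sigma^r(V)=V$. Let $\mathcal{L}_{\gamma,G}^{\mathrm{pr}}$ be the quotient of $\mathcal{L}_\gamma^{\mathrm{pr}}$ by the action of $\sigma$: its elements are the $\sigma$-orbits $[V]$, with $[W]\le[V]$ if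 and only if $W\subseteq\sigma^i(V)$ for some $i$. Each node carries the weight $(\dim V,\exp V,\deg V)$, which depends only on $[V]$. One writes $V$ for the node $[V]$. For $V\in\mathcal{L}_\gamma^{\mathrm{pr}}$ put $V^0=V\setminus\bigcup_{W\in\mathcal{L}_\gamma^{\mathrm{pr}},\,W\subsetneq V}W$. If $r=\deg V$, then $V^0$ is defined over $k_r$ (i.e. stable under $\sigma^r$), and $$f_{V^0}(x)=\sum_{n\ge0}a_n x^n,\qquad \overline f_{V^0}(x)=\sum_{n\ge0}\overline a_n x^n,$$ where $a_n$ (resp. $\overline a_n$) is the number of $n$-subsets (resp. $n$-multisets) of $V^0(\bar k)$ stable under $\sigma^r$ (with $a_0=\overline a_0=1$). Let $\mathcal{C}$ be a set of representatives of the conjugacy classes of $\Gamma$. Two elements $\gamma,\gamma'\in\mathcal{C}$ have the same subtype if there is a poset isomorphism $\mathcal{L}_{\gamma,G}^{\mathrm{pr}}\to\mathcal{L}_{\gamma',G}^{\mathrm{pr}}$ preserving the weight $(\dim,\exp,\deg)$ of each node. $\mathcal{S}$ is the set of equivalence classes (subtypes). For $\alpha\in\mathcal{S}$, $\mathcal{L}(\alpha)$ denotes $\mathcal{L}_{\gamma,G}^{\mathrm{pr}}$ for any $\gamma\in\mathcal{C}$ of subtype $\alpha$, and $$M_\alpha=\sum_{\gamma\in\mathcal{C},\ \gamma\text{ of subtype }\alpha}|\Gamma_\gamma|^{-1},$$ where $\Gamma_\gamma$ is the centralizer of $\gamma$ in $\Gamma$. The products over $\mathcal{L}(\alpha)$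 in the claim are computed with any such $\gamma$ (they depend only on $\alpha$). *)

(* Defs.v *)
From HB Require Import structures.
From mathcomp Require Import all_boot all_order all_algebra all_fingroup.
From mathcomp Require Import finmap multiset.
From mathcomp Require Import boolp classical_sets functions cardinality.

Set Implicit Arguments.
Unset Strict Implicit.
Unset Printing Implicit Defensive.

Import GRing.Theory.

Local Open Scope ring_scope.
Local Open Scope classical_set_scope.

(* Only applied to finite sets: fset_set returns the empty fset otherwise. *)
Definition ncard (T : choiceType) (A : set T) : nat := #|` fset_set A|%fset.

(* The least m >= 1 satisfying P (0 if there is none). *)
Definition least_pos (P : nat -> Prop) : nat :=
  xget 0%N [set m : nat | [/\ (0 < m)%N, P m &
                            forall j : nat, (0 < j)%N -> P j -> (m <= j)%N]].

Definition fset_map (T : choiceType) (f : T -> T) (S : {fset T}) : {fset T} :=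
  [fset f p | p in S]%fset.

(* The multiplicity of q in the image is the sum of those of its preimages. *)
Definition mset_map (T : choiceType) (f : T -> T) (S : {mset T}%mset) :
  {mset T}%mset := seq_mset [seq f p | p <- S].

Definition stable_nsets (T : choiceType) (X : set T) (f : T -> T) (n : nat) :
  set {fset T} :=
  [set S : {fset T} | [/\ forall p, p \in S -> X p, #|` S|%fset = n & fset_map f S = S]].

Definition stable_nmsets (T : choiceType) (X : set T) (f : T -> T) (n : nat) :
  set {mset T}%mset :=
  [set S : {mset T}%mset | [/\ forall p, p \in S -> X p, size S = n & mset_map f S = S]].

(* Formal power series over rat, as sequences of coefficients. *)
Definition fps : Type := nat -> rat.

Definition fps_one : fps := fun n => (n == 0%N)%:R.

Definition fps_mul (f g : fps) : fps :=
  fun n => \sum_(i < n.+1) f i * g (n - i)%N.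

(* f(x^d), for d > 0. *)
Definition fps_subst (d : nat) (f : fps) : fps :=
  fun n => if (d %| n)%N then f (n %/ d)%N else 0.

Fact fps_mulE (f g : fps) (m n : nat) : (n < m)%N ->
  fps_mul f g n = ((\poly_(i < m) f i) * (\poly_(i < m) g i))`_n.
Proof.
move=> lt_nm; rewrite coefM; apply: eq_bigr => i _; rewrite !coef_poly.
by rewrite !(leq_ltn_trans _ lt_nm) ?leq_subr // -ltnS.
Qed.

Fact fps_mulC : commutative fps_mul.
Proof.
by move=> f g; apply/funext => n; rewrite !(@fps_mulE _ _ n.+1) // mulrC.
Qed.

Fact fps_mulA : associative fps_mul.
Proof.
have aux (f g h : fps) n : fps_mul (fps_mul f g) h n =
    ((\poly_(i < n.+1) f i) * (\poly_(i < n.+1) g i) * \poly_(i < n.+1) h i)`_n.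
  rewrite coefM; apply: eq_bigr => i _.
  by rewrite (@fps_mulE _ _ n.+1) // coef_poly ltnS leq_subr.
move=> f g h; apply/funext => n.
by rewrite fps_mulC !aux mulrC mulrA.
Qed.

Fact fps_mul1 : left_id fps_one fps_mul.
Proof.
move=> f; apply/funext => n; rewrite /fps_mul big_ord_recl /= subn0 mul1r.
by rewrite big1 ?addr0 // => i _; rewrite mul0r.
Qed.

HB.instance Definition _ :=
  Monoid.isComLaw.Build fps fps_one fps_mul fps_mulA fps_mulC fps_mul1.

Section PGL.

Variables (k : finFieldType) (N : nat).

Definition scalar_GL : {set {'GL_N.+1[k]}} :=
  [set u : {'GL_N.+1[k]} | is_scalar_mx (GLval u)]%SET.

Fact scalar_GL_group_set : group_set scalar_GL.
Proof.
apply/group_setP; split=> [|u v]; first by rewrite inE GL_1E scalar_mx_is_scalar.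
rewrite !inE GL_ME => /is_scalar_mxP[a ->] /is_scalar_mxP[b ->].
by rewrite -mulmxE -scalar_mxM scalar_mx_is_scalar.
Qed.

Canonical scalar_GL_group := Group scalar_GL_group_set.

(* Scalar matrices being central, every element of GL normalises scalar_GL,   *)
(* so the type of cosets is the whole of PGL_{N+1}(k).                        *)
Definition PGL : finGroupType := coset_of scalar_GL.

End PGL.

Section Projective.

Variables (k : finFieldType) (K : closedFieldType) (iota : {rmorphism k -> K}).
Variable N : nat.

(* The linear subvarieties of P^N(K) are the nonzero subspaces of K^(N+1),    *)
(* and its points are the lines.                                              *)
Local Notation Lin := {vspace 'rV[K]_N.+1}.

Definition points : set Lin := [set p | \dim p = 1%N].

Definition pdim (V : Lin) : nat := (\dim V).-1.

(* gamma acts on row vectors by right multiplication; the choice of the       *)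
(* matrix representing gamma has no effect on subspaces.                      *)
Definition pgl_act (g : PGL k N) (V : Lin) : Lin :=
  (linfun (mulmxr (map_mx iota (GLval (repr g)))) @: V)%VS.

Definition frob_vec (v : 'rV[K]_N.+1) : 'rV[K]_N.+1 :=
  map_mx (fun x => x ^+ #|k|) v.

(* The image of V under frob_vec, which is semilinear: it is spanned by the   *)
(* image of a basis.                                                          *)
Definition frob (V : Lin) : Lin := <<[seq frob_vec v | v <- vbasis V]>>%VS.

Definition pgl_orbits (T : Type) (act : PGL k N -> T -> T) (X : set T) :
  set (set T) := [set (range (act^~ S)) | S in X].

Definition num_orbits (n : nat) : nat :=
  ncard (pgl_orbits (fun g => fset_map (pgl_act g))
                    (stable_nsets points frob n)).

Definition num_morbits (n : nat) : nat :=
  ncard (pgl_orbits (fun g => mset_map (pgl_act g))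
                    (stable_nmsets points frob n)).

Definition inv_lin (g : PGL k N) : set Lin :=
  [set V | V != 0%VS /\ pgl_act g V = V].

Definition pexp (g : PGL k N) (V : Lin) : nat :=
  least_pos (fun m => forall p, points p -> (p <= V)%VS ->
                                iter m (pgl_act g) p = p).

Definition proper_lin (g : PGL k N) : set Lin :=
  [set V | inv_lin g V /\
     forall W, inv_lin g W -> (V <= W)%VS -> V != W ->
               (pexp g V < pexp g W)%N].

Definition pdeg (V : Lin) : nat := least_pos (fun r => iter r frob V = V).

(* V^0 *)
Definition open_part (g : PGL k N) (V : Lin) : set Lin :=
  [set p | [/\ points p, (p <= V)%VS &
     forall W, proper_lin g W -> (W <= V)%VS -> W != V -> ~~ (p <= W)%VS]].

Definition open_gf (g : PGL k N) (V : Lin) : fps :=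
  fun n => (ncard (stable_nsets (open_part g V) (iter (pdeg V) frob) n))%:R.

Definition open_mgf (g : PGL k N) (V : Lin) : fps :=
  fun n => (ncard (stable_nmsets (open_part g V) (iter (pdeg V) frob) n))%:R.

Definition frob_orbit (V : Lin) : set Lin := range (fun i => iter i frob V).

Definition nodes (g : PGL k N) : set (set Lin) :=
  [set frob_orbit V | V in proper_lin g].

Definition node_le (A B : set Lin) : Prop :=
  exists W V, [/\ A = frob_orbit W, B = frob_orbit V &
                  exists i, (W <= iter i frob V)%VS].

Definition node_rep (A : set Lin) : Lin := xget 0%VS A.

Definition weight (g : PGL k N) (A : set Lin) : nat * nat * nat :=
  (pdim (node_rep A), pexp g (node_rep A), pdeg (node_rep A)).

Definition same_subtype (g h : PGL k N) : Prop :=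
  exists phi : set Lin -> set Lin,
    [/\ set_bij (nodes g) (nodes h) phi,
        forall A B, nodes g A -> nodes g B ->
          (node_le A B <-> node_le (phi A) (phi B)) &
        forall A, nodes g A -> weight h (phi A) = weight g A].

Definition subtypes (C : {set PGL k N}) : {set {set PGL k N}} :=
  equivalence_partition (fun g h => `[< same_subtype g h >]) C.

(* M_alpha; a subtype alpha is a subset of the set of representatives. *)
Definition mass (alpha : {set PGL k N}) : rat :=
  \sum_(g in alpha) (#|'C[g]%g|%:R)^-1.

Definition node_prod (F : PGL k N -> Lin -> fps) (g : PGL k N) : fps :=
  \big[fps_mul/fps_one]_(A <- fset_set (nodes g))
     fps_subst (pexp g (node_rep A) * pdeg (node_rep A))%N (F g (node_rep A)).

End Projective.

Arguments open_gf {k K} iota {N} g V.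
Arguments open_mgf {k K} iota {N} g V.

(* Main.v *)
(* By Burnside's lemma the number of orbits is the sum over [c in C] of       *)
(* 1/|C(c)| times the number of rational n-(multi)sets fixed by [c], so it is *)
(* enough to compute the latter and to see that the node product depends only *)
(* on the subtype. A point p with gamma-orbit of size e lies in V^0 for a     *)
(* unique proper V, its hull, which is an eigenspace of gamma^e; hence the    *)
(* V^0 partition the points and gamma acts on V^0 with all orbits of size     *)
(* e = exp V. A (multi)set stable under gamma and sigma is a (multi)set of    *)
(* <sigma, gamma>-orbits, so its generating function is a product over these  *)
(* orbits that depends only on how many there are of each size. These numbers *)
(* are in turn determined by the numbers of p in the node [V] with            *)
(* sigma^s p = gamma^i p. By Lang's theorem the number of such p in all of V  *)
(* depends only on dim V and s; since distinct conjugates of V are disjoint,  *)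
(* induction over the poset shows that the count for the node [V] depends     *)
(* only on the weighted poset, and in particular not on i. Independence of i  *)
(* identifies the <sigma, gamma>-orbits in the node with the sigma^r-orbits   *)
(* in V^0, r = deg V, with sizes multiplied by exp V * deg V.                 *)

Require Import Defs.

From mathcomp Require Import all_boot all_order all_algebra all_fingroup.
From mathcomp Require Import all_solvable all_field finmap multiset.
From mathcomp Require Import boolp classical_sets functions cardinality.

Set Implicit Arguments.
Unset Strict Implicit.
Unset Printing Implicit Defensive.

Import GRing.Theory Num.Theory.
Local Open Scope ring_scope.

(** * Semilinear fixed vectors over an algebraically closed field *)

(** Coefficients of x^n are compared for a fixed n. [burnside], [sum_classes] and [sum_subtypes]
    turn the orbit count into the sum over subtypes, given two facts: the number of stable
    collections fixed by gamma is the coefficient of the node product at gamma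
    ([card_inv_node_prod]), and this coefficient depends only on the subtype ([node_prod_iso]).

    Geometry: a nonzero V is proper exactly when it is an eigenspace of gamma^(exp V) ([proper_eig],
    [eig_proper]), so V^0 consists of the points of V whose gamma-period is exactly exp V
    ([open_partP]).

    Arithmetic: a Lang basis ([lang_basis]) linearises the condition sigma^s p = gamma^i p on an
    invariant V with sigma^s V = V. The number of such points depends only on dim V and s
    ([card_fixed_in_le]), and [sum_node_fix] with induction over the poset carries this over to
    single nodes ([card_node_fix]).

    Combinatorics: orbits are never matched one by one. By [eq_fps_prod_ghost] two products of orbit
    factors agree as soon as, for each t, equally many points lie in orbits of size dividing t.
    [ghost_node] and [ghost_open] compute this number for the <sigma, gamma>-orbits in a node and
    for the sigma^r-orbits in V^0 with sizes scaled by exp V * deg V, and find the same value. *)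

Lemma pchar_nat_eq0 (R : nzRingType) (Q : nat) :
  (1 < Q)%N -> ([pchar R]).-nat Q -> Q%:R = 0 :> R.
Proof.
move=> Q1 chQ; have pQ := pdiv_prime Q1.
have /pnatP := chQ => /(_ (ltnW Q1)) /(_ _ pQ (pdiv_dvd _)) chp.
by apply/eqP; rewrite -(dvdn_pcharf chp) pdiv_dvd.
Qed.

(** The derivative of X^Q - X is -1, so this polynomial is separable; its roots form the subfield
    with Q elements. *)
Lemma roots_frobenius (K : closedFieldType) (Q : nat) :
  (1 < Q)%N -> ([pchar K]).-nat Q ->
  exists rs : seq K, [/\ uniq rs, size rs = Q &
    forall x, (x \in rs) = (x ^+ Q == x)].
Proof.
move=> Q1 chQ; set P : {poly K} := 'X^Q - 'X.
have sP : size P = Q.+1.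
  by rewrite size_polyDl ?size_polyXn // size_polyN size_polyX.
have P0 : P != 0 by rewrite -size_poly_eq0 sP.
have mP : lead_coef P = 1.
  by rewrite lead_coefDl ?lead_coefXn // size_polyN size_polyX size_polyXn.
have [rs def_P] := closed_field_poly_normal P.
move: def_P; rewrite mP scale1r => def_P.
exists rs; split.
- rewrite -separable_prod_XsubC -def_P unlock.
  have -> : P^`() = (-1)%:P.
    rewrite derivB derivX derivXn -[_ *+ Q]mulr_natr -polyC_natr.
    by rewrite pchar_nat_eq0 // mulr0 sub0r polyCN.
  by rewrite polyCN -scaleN1r coprimepZr ?oppr_eq0 ?oner_eq0 // coprimep1.
- by have := sP; rewrite def_P size_prod_XsubC => -[].
- move=> x; rewrite -root_prod_XsubC -def_P rootE !hornerE_comm.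
  by rewrite hornerXn subr_eq0.
Qed.

(** By the pigeonhole principle two of the first [size s + 1] iterates agree, and injectivity
    cancels the preperiod. *)
Lemma iter_periodic (T : eqType) (f : T -> T) (s : seq T) (x : T) :
  injective f -> x \in s -> {homo f : y / y \in s} ->
  exists2 r, (0 < r <= size s)%N & iter r f x = x.
Proof.
move=> inj_f xs fs; have iter_s i : iter i f x \in s by elim: i => //= i /fs.
have /trajectP[i lt_i Ei] : looping f x (size s).
  rewrite -[looping _ _ _]negbK -looping_uniq; apply/negP => U.
  have /(uniq_leq_size U) : {subset traject f x (size s).+1 <= s}.
    by move=> y /trajectP[i _ ->].
  by rewrite size_traject ltnn.
exists (size s - i)%N; first by rewrite subn_gt0 lt_i leq_subr.
have inj_iter j : injective (iter j f) by elim: j => // j IH y z /= /inj_f/IH.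
by apply: (inj_iter i); rewrite -iterD subnKC // ltnW.
Qed.

Section Lang.

Variables (K : closedFieldType) (Fr : {rmorphism K -> K}) (Q : nat).
Hypotheses (Q_gt1 : (1 < Q)%N) (pcharQ : ([pchar K]).-nat Q).
Hypothesis FrE : forall x, Fr x = x ^+ Q.
Variables (n : nat) (U : 'M[K]_n.+1).
Hypothesis FrU : map_mx Fr U = U.

Lemma map_mx_fixX j : map_mx Fr (U ^+ j) = U ^+ j.
Proof.
elim: j => [|j IH]; first by rewrite map_mx1.
by rewrite exprS -mulmxE map_mxM FrU IH.
Qed.

(* If the additive polynomial [p(X) = sum_t (Fr^t(v) U^(m-t) col) X^(Q^t)]    *)
(* vanished on the field with Q^m elements it would have too many roots.      *)
Lemma averaging_neq0 (m : nat) (v : 'rV[K]_n.+1) (col : 'cV[K]_n.+1) :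
  (0 < m)%N -> U ^+ m = 1 -> iter m (map_mx Fr) v = v -> v *m col != 0 ->
  exists w : 'rV[K]_n.+1,
    [/\ map_mx Fr w = w *m U, w *m col != 0 &
        forall B : 'M[K]_n.+1, stablemx B U -> (map_mx Fr B <= B)%MS ->
          (v <= B)%MS -> (w <= B)%MS].
Proof.
move=> m_gt0 Um Frv vcol; pose v_ t := iter t (map_mx Fr) v.
have Qm1 : (1 < Q ^ m)%N by rewrite -(exp1n m) ltn_exp2r.
have chQm : ([pchar K]).-nat (Q ^ m)%N by rewrite pnatX pcharQ.
have [rs [Urs size_rs in_rs]] := roots_frobenius Qm1 chQm.
pose a t : K := (v_ t *m U ^+ (m - t) *m col) 0 0.
pose P : {poly K} := \sum_(t < m) a t *: 'X^(Q ^ t).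
have P0 : P != 0.
  (* The coefficient of X comes from t = 0 alone and equals [v *m col], because U^m = 1. *)
  apply/eqP => /(congr1 (fun q : {poly K} => q`_1)).
  rewrite coef_sum coef0 (bigD1 (Ordinal m_gt0)) //= big1 ?addr0 => [|t t0].
    rewrite coefZ coefXn /= mulr1 /a subn0 Um mulmx1 => h.
    by case/eqP: vcol; apply/matrixP => i j; rewrite !ord1 h mxE.
  rewrite coefZ coefXn; case: eqP => [/eqP|]; last by rewrite mulr0.
  rewrite eq_sym -[X in _ == X](expn0 Q) eqn_exp2l // => t0'.
  by rewrite -val_eqE /= t0' in t0.
have sP : (size P <= size rs)%N.
  rewrite size_rs; apply: leq_trans (size_sum _ _ _) _.
  apply/bigmax_leqP => t _; apply: leq_trans (size_scale_leq _ _) _.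
  by rewrite size_polyXn ltn_exp2l.
have /allPn[c c_rs Pc] : ~~ all (root P) rs.
  apply/negP => all_rs; have := max_poly_roots P0 all_rs Urs.
  by rewrite ltnNge sP.
(* This is the sum of the iterates of [c *: v] under the semilinear map x -> Fr(x) U^-1. Applying Fr
   shifts t by one, and the sum closes up since c^(Q^m) = c, U^m = 1 and Fr^m v = v. *)
exists (\sum_(t < m) c ^+ (Q ^ t) *: (v_ t *m U ^+ (m - t))); split.
- pose G t := c ^+ (Q ^ t) *: (v_ t *m U ^+ (m - t).+1).
  transitivity (\sum_(t < m) G t.+1).
    rewrite map_mx_sum; apply: eq_bigr => t _; rewrite map_mxZ map_mxM.
    by rewrite map_mx_fixX /G subnSK // FrE -exprM -expnSr.
  apply: (addrI (G 0%N)).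
  transitivity (\sum_(t < m.+1) G t); first by rewrite big_ord_recl.
  rewrite big_ord_recr /= addrC; congr (_ + _).
    rewrite /G subnn subn0 (exprSr U m) Um mul1r expr1 expn0 expr1.
    by move: c_rs; rewrite in_rs => /eqP->; rewrite /v_ Frv.
  rewrite mulmx_suml; apply: eq_bigr => t _.
  by rewrite -scalemxAl -mulmxA /G exprSr.
- apply: contra Pc => /eqP h; apply/eqP; rewrite horner_sum.
  transitivity ((0 : 'M[K]_1) 0 0); last by rewrite mxE.
  rewrite -h mulmx_suml summxE; apply: eq_bigr => t _.
  by rewrite hornerZ hornerXn -scalemxAl mxE mulrC.
- move=> B BU FrB vB; apply: summx_sub => t _; apply: scalemx_sub.
  elim: (m - t)%N => [|d IH]; last first.
    by rewrite exprSr mulmxA; apply: submx_trans (submxMr _ IH) BU.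
  rewrite mulmx1 /v_; elim: (t : nat) => //= i IH.
  by apply: submx_trans FrB; rewrite map_submx.
Qed.

(** Lang's theorem in linear form. Take a free family of solutions in [B] of maximal size. If a row
    of [B] were outside its span, some column of the cokernel would detect it, and [averaging_neq0]
    would give a solution in [B] that the same column detects, contradicting maximality. *)
Lemma lang_basis (B : 'M[K]_n.+1) : stablemx B U ->
  (map_mx Fr B <= B)%MS ->
  (exists m, [/\ (0 < m)%N, U ^+ m = 1 & iter m (map_mx Fr) B = B]) ->
  exists A : 'M[K]_(\rank B, n.+1),
    [/\ row_free A, (A :=: B)%MS & map_mx Fr A = A *m U].
Proof.
move=> BU FrB [m [m_gt0 Um FrmB]].
pose good r := exists A : 'M[K]_(r, n.+1),
  [/\ row_free A, (A <= B)%MS & map_mx Fr A = A *m U].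
have ex_good : exists r, `[< good r >].
  exists 0; apply/asboolP; exists 0; split; last by rewrite map_mx0 mul0mx.
  - by rewrite /row_free mxrank0.
  - exact: sub0mx.
have good_le r : `[< good r >] -> (r <= \rank B)%N.
  by case/asboolP=> A [/eqP rA /mxrankS]; rewrite rA.
case: (ex_maxnP ex_good good_le) => r /asboolP[A [freeA AB FrA]] max_r.
have BA : (B <= A)%MS.
  apply: contraT => /row_subPn[i]; set v := row i B => nvA.
  have Frv : iter m (map_mx Fr) v = v.
    rewrite /v -[in RHS]FrmB; elim: (m) => //= j ->.
    by rewrite map_row.
  have [j vj] : exists j, v *m col j (cokermx A) != 0.
    move: nvA; rewrite submxE => /eqP h; apply/existsP; rewrite -negb_forall.
    apply/negP => /forallP h'; apply: h; apply/matrixP => i0 j.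
    have /eqP/matrixP/(_ i0 0) := h' j.
    by rewrite colE mulmxA -colE !mxE.
  have [w [Frw wj wB]] := averaging_neq0 m_gt0 Um Frv vj.
  have {}wB : (w <= B)%MS by apply: wB => //; apply: row_sub.
  have nwA : ~~ (w <= A)%MS.
    apply: contra wj; rewrite submxE => /eqP h.
    by rewrite colE mulmxA h mul0mx.
  suff /max_r : `[< good (1 + r)%N >] by rewrite ltnn.
  apply/asboolP; exists (col_mx w A); split.
  - apply: inj_row_free => x; rewrite -[x]hsubmxK mul_row_col.
    rewrite [lsubmx x]mx11_scalar mul_scalar_mx; set a := lsubmx x 0 0.
    have [-> | a0] := eqVneq a 0.
      rewrite scale0r add0r => /eqP.
      rewrite -(mul0mx _ A) (inj_eq (row_free_inj freeA)) => /eqP->.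
      by rewrite raddf0 row_mx0.
    move/eqP; rewrite addr_eq0 => /eqP aw; case/negP: nwA.
    by rewrite -(eqmx_scale w a0) aw eqmx_opp submxMl.
  - by rewrite col_mx_sub AB wB.
  - by rewrite map_col_mx mul_col_mx Frw FrA.
have AB' : (A :=: B)%MS by apply/eqmxP; rewrite AB BA.
have rE : r = \rank B by rewrite -AB'; apply/esym/eqP.
by move: A freeA AB FrA BA AB'; rewrite rE => A freeA _ FrA _ AB'; exists A.
Qed.

End Lang.

(** * Generating functions of weighted multisets *)

Lemma fps_subst1 (d : nat) : (0 < d)%N -> fps_subst d fps_one = fps_one.
Proof.
move=> d_gt0; apply/funext => n; rewrite /fps_subst /fps_one.
case: ifPn => [/dvdnP[k ->]|];
  first by rewrite mulnK // muln_eq0 (gtn_eqF d_gt0) orbF.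
by case: eqP => // ->; rewrite dvdn0.
Qed.

Lemma fps_substM (d : nat) (f g : fps) : (0 < d)%N ->
  fps_subst d (fps_mul f g) = fps_mul (fps_subst d f) (fps_subst d g).
Proof.
move=> d_gt0; apply/funext => n; rewrite [RHS]/fps_mul {1}/fps_subst.
rewrite (bigID (fun i : 'I_n.+1 => d %| i)%N) /= [X in _ + X]big1 =>
  [|i /negPf nd].
  2: by rewrite {1}/fps_subst nd mul0r.
rewrite addr0; case: ifPn => [/dvdnP[k ->]|ndn].
  rewrite mulnK // /fps_mul.
  rewrite (reindex_onto (fun i : 'I_k.+1 => inord (i * d) : 'I_(k * d).+1)
                        (fun j => inord (j %/ d))) /=.
    have lt_i (i : 'I_k.+1) : (i * d < (k * d).+1)%N.
      by rewrite ltnS leq_mul2r -ltnS ltn_ord orbT.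
    apply: eq_big => [i|i _].
      by rewrite inordK // dvdn_mull // mulnK // inord_val eqxx.
    by rewrite inordK // /fps_subst -mulnBl !dvdn_mull // !mulnK.
  move=> j /dvdnP[m Em]; apply: val_inj => /=.
  have le_mk : (m <= k)%N by rewrite -(leq_pmul2r d_gt0) -Em -ltnS.
  by rewrite Em mulnK // inordK // inordK ?ltnS ?leq_mul2r ?le_mk ?orbT.
rewrite big1 // => i di; rewrite {2}/fps_subst.
case: ifPn => [dni|]; last by rewrite mulr0.
by case/negP: ndn; rewrite -(@subnK i n) ?dvdn_add // -ltnS.
Qed.

Lemma fps_subst_subst (d e : nat) (f : fps) : (0 < d)%N ->
  fps_subst d (fps_subst e f) = fps_subst (d * e) f.
Proof.
move=> d_gt0; apply/funext => n; rewrite /fps_subst.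
case: ifPn => [/dvdnP[k ->]|ndn].
  by rewrite mulnK // (mulnC k) dvdn_pmul2l // divnMl.
by case: ifP => // /dvdnP[k En]; rewrite En mulnCA dvdn_mulr in ndn.
Qed.

Lemma fps_subst_prod (d : nat) (I : Type) (r : seq I) (P : pred I)
  (F : I -> fps) :
  (0 < d)%N ->
  fps_subst d (\big[fps_mul/fps_one]_(i <- r | P i) F i) =
  \big[fps_mul/fps_one]_(i <- r | P i) fps_subst d (F i).
Proof.
move=> d_gt0; apply: big_morph; last exact: fps_subst1.
by move=> f g; apply: fps_substM.
Qed.

(** Products may be computed modulo x^(n+1). *)
Lemma fps_prod_congr (n : nat) (I : Type) (r : seq I) (P : pred I)
  (F G : I -> fps) :
  (forall i k, P i -> (k <= n)%N -> F i k = G i k) ->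
  forall k, (k <= n)%N ->
  (\big[fps_mul/fps_one]_(i <- r | P i) F i) k =
  (\big[fps_mul/fps_one]_(i <- r | P i) G i) k.
Proof.
move=> FG; elim/big_ind2: _ => // [f1 f2 g1 g2 IH1 IH2 k le_kn|i Pi k];
  last exact: FG.
apply: eq_bigr => i _; rewrite IH1 ?IH2 //.
  exact: leq_trans (leq_subr _ _) le_kn.
by apply: leq_trans le_kn; rewrite -ltnS.
Qed.

Lemma coef_fps_prod (I : finType) (F : I -> fps) (n : nat) :
  (\big[fps_mul/fps_one]_i F i) n =
  \sum_(m : {ffun I -> 'I_n.+1} | (\sum_i m i == n)%N) \prod_i F i (m i).
Proof.
(* Truncating every factor gives a product of polynomials, which expands by distributivity. *)
transitivity ((\prod_i \poly_(j < n.+1) F i j)`_n).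
  have R : forall k, (k <= n)%N -> (\big[fps_mul/fps_one]_i F i) k =
      (\prod_i \poly_(j < n.+1) F i j)`_k; last exact: R.
  apply: (big_ind2 (fun (f : fps) (p : {poly rat}) =>
    forall k, (k <= n)%N -> f k = p`_k)) =>
      [k _|f p g q IHf IHg k le_kn|i _ k le_kn].
  - by rewrite coef1.
  - rewrite coefM; apply: eq_bigr => i _; rewrite IHf ?IHg //.
      exact: leq_trans (leq_subr _ _) le_kn.
    by apply: leq_trans le_kn; rewrite -ltnS.
  - by rewrite coef_poly ltnS le_kn.
under eq_bigr do rewrite poly_def.
rewrite bigA_distr_bigA /= coef_sum [RHS]big_mkcond; apply: eq_bigr => m _ /=.
rewrite scaler_prod coefZ -expr_sum coefXn eq_sym.
by case: ifP; rewrite ?mulr1 ?mulr0.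
Qed.

(* [P] selects the admissible multiplicities: [leq^~ 1] for sets, [predT] for *)
(* multisets.                                                                 *)
Definition fps_ind (P : pred nat) : fps := fun n => (P n)%:R.

Lemma card_can_in (T U : finType) (A : {set T}) (B : {set U}) (f : T -> U)
  (g : U -> T) :
  {in A, forall x, f x \in B /\ g (f x) = x} ->
  {in B, forall y, g y \in A /\ f (g y) = y} -> #|A| = #|B|.
Proof.
move=> fA gB; have injf : {in A &, injective f}.
  by move=> x y /fA[_ {2}<-] /fA[_ {2}<-] ->.
rewrite -(card_in_imset injf); apply: eq_card => y.
apply/imsetP/idP => [[x /fA[fx _] -> //]|/gB[gy fgy]].
by exists (g y).
Qed.

Section Atoms.

Variables (T J : finType) (at_ : T -> J) (D : {set T}) (P : pred nat).
Hypothesis P0 : P 0%N.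

Let w j := #|[set x in D | at_ x == j]|.

(** A function that vanishes off [D] and is constant on the fibres of [at_] amounts to one
    admissible multiplicity per fibre, and a fibre with w elements contributes w times its
    multiplicity to the total. *)
Lemma card_atom_functions (n : nat) :
  #|[set m : {ffun T -> 'I_n.+1} |
      [&& [forall x, (x \notin D) ==> (m x == 0%N :> nat)],
          [forall x in D, forall y in D, (at_ x == at_ y) ==> (m x == m y)],
          [forall x, P (m x)] & (\sum_x m x == n)%N]]|%:R =
  (\big[fps_mul/fps_one]_(j in at_ @: D) fps_subst (w j) (fps_ind P)) n.
Proof.
rewrite big_mkcond coef_fps_prod.
(* [M j] stands for the total mass on the fibre over j; dividing by the size of the fibre recovers
   the multiplicity. *)
pose ok (M : {ffun J -> 'I_n.+1}) j := if j \in at_ @: D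
  then ((w j %| M j) && P (M j %/ w j))%N else M j == 0%N :> nat.
rewrite (eq_bigr (fun M : {ffun J -> 'I_n.+1} => ([forall j, ok M j])%:R));
  last first.
  move=> M _; have [/forallP okM|/forallPn[j nok]] := boolP [forall j, ok M j].
    apply: big1 => j _; have := okM j; rewrite /ok /fps_subst /fps_ind /fps_one.
    by case: ifP => _ => [/andP[-> ->]|->].
  rewrite (bigD1 j) //=; move: nok; rewrite /ok /fps_subst /fps_ind /fps_one.
  case: ifP => _; last by move=> /negPf->; rewrite mul0r.
  by case: dvdn => /=; rewrite ?mul0r // => /negPf->; rewrite mul0r.
rewrite -natr_sum (eq_bigr (fun M => if [forall j, ok M j] then 1%N else 0%N));
  last first.
  by move=> M _; case: [forall j, _].
rewrite -big_mkcondr sum1dep_card; congr _%:R.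
have w_gt0 x : x \in D -> (0 < w (at_ x))%N.
  by move=> xD; apply/card_gt0P; exists x; rewrite inE xD eqxx.
pose f (m : {ffun T -> 'I_n.+1}) :=
  [ffun j => inord (\sum_(x in D | at_ x == j) m x)] : {ffun J -> 'I_n.+1}.
pose g (M : {ffun J -> 'I_n.+1}) :=
  [ffun x => if x \in D then inord (M (at_ x) %/ w (at_ x)) else ord0] :
    {ffun T -> 'I_n.+1}.
have gE M x : g M x = (if x \in D then M (at_ x) %/ w (at_ x) else 0)%N :> nat.
  rewrite ffunE; case: ifP => // _; rewrite inordK //.
  exact: leq_ltn_trans (leq_div _ _) (ltn_ord _).
apply: (@card_can_in _ _ _ _ f g).
- move=> m; rewrite inE =>
    /and4P[/forallP suppm /forall_inP cstm /forallP Pm /eqP summ].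
  have sumD : (\sum_(x in D) m x = n)%N.
    rewrite -[RHS]summ [RHS](bigID (mem D)) /= [X in (_ + X)%N]big1 ?addn0 // =>
      x.
    by move=> xD; apply/eqP; move/implyP: (suppm x); apply.
  have fE j : f m j = (\sum_(x in D | at_ x == j) m x)%N :> nat.
    rewrite ffunE inordK // ltnS -[leqRHS]sumD.
    rewrite [leqRHS](bigID (fun x => at_ x == j)) /=; exact: leq_addr.
  have fat x : x \in D -> f m (at_ x) = (m x * w (at_ x))%N :> nat.
    move=> xD; rewrite fE (eq_bigr (fun=> m x : nat)).
      by rewrite sum_nat_cond_const mulnC.
    move=> y /andP[yD /eqP yx]; apply/eqP; move/forall_inP: (cstm y yD) =>
      /(_ x xD).
    by rewrite yx eqxx.
  split; last first.
    apply/ffunP => x; apply: val_inj => /=; rewrite gE.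
    case: ifPn => xD; first by rewrite fat // mulnK // w_gt0.
    by apply/esym/eqP; move/implyP: (suppm x); apply.
  rewrite inE; apply/andP; split.
    rewrite -[X in _ == X]sumD (partition_big at_ predT) //=.
    by apply/eqP/eq_bigr => j _; rewrite fE.
  apply/forallP => j; rewrite /ok; case: ifPn => [/imsetP[x xD ->]|jD].
    by rewrite fat // dvdn_mull // mulnK ?w_gt0 ?Pm.
  rewrite fE big1 // => x /andP[xD /eqP xj]; case/negP: jD.
  by rewrite -xj imset_f.
- move=> M; rewrite inE => /andP[/eqP sumM /forallP okM].
  have okD x : x \in D -> (w (at_ x) %| M (at_ x))%N /\
    P (M (at_ x) %/ w (at_ x))%N.
    by move=> xD; have := okM (at_ x); rewrite /ok imset_f // => /andP.
  have sumg j : (\sum_(x in D | at_ x == j) g M x = M j)%N.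
    have [/imsetP[x xD ->]|jD] := boolP (j \in at_ @: D).
      rewrite (eq_bigr (fun=> (M (at_ x) %/ w (at_ x))%N)).
        rewrite sum_nat_cond_const -[RHS](@divnK (w (at_ x))) ?(okD x xD).1 //.
        by rewrite mulnC.
      by move=> y /andP[yD /eqP yx]; rewrite gE yD yx.
    rewrite big1 => [|x /andP[xD /eqP xj]]; last by case/negP: jD;
      rewrite -xj imset_f.
    by have := okM j; rewrite /ok (negPf jD) => /eqP.
  split; last by apply/ffunP => j; rewrite ffunE sumg inord_val.
  rewrite inE; apply/and4P; split.
  + by apply/forallP => x; apply/implyP => xD; rewrite gE (negPf xD).
  + apply/forall_inP => x xD; apply/forall_inP => y yD; apply/implyP => /eqP xy.
    by apply/eqP/val_inj; rewrite /= !gE xD yD xy.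
  + by apply/forallP => x; rewrite gE; case: ifP => // /okD[].
  + rewrite -[X in _ == X]sumM (bigID (mem D)) /= [X in (_ + X)%N]big1 =>
      [|x xD].
      rewrite addn0 (partition_big at_ predT) //=.
      by apply/eqP/eq_bigr => j _; rewrite sumg.
    by rewrite gE (negPf xD).
Qed.

End Atoms.

Section Ghost.

Variables (J1 J2 : finType) (S1 : {set J1}) (S2 : {set J2}).
Variables (w1 : J1 -> nat) (w2 : J2 -> nat) (n : nat).

(** Isolating the weight s itself makes the ghost sums a triangular system in the numbers of atoms
    of each weight. *)
Lemma ghost_split (J : finType) (S : {set J}) (w : J -> nat) (s : nat) :
  (0 < s)%N ->
  (\sum_(j in S | (w j %| s)%N) w j =
   s * #|[set j in S | w j == s]| +
   \sum_(d < s | (d %| s)%N) d * #|[set j in S | w j == d]|)%N.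
Proof.
move=> s_gt0; rewrite
  (partition_big (fun j => inord (w j) : 'I_s.+1) (fun d => (d %| s)%N)) /=.
  rewrite (bigD1 ord_max) ?dvdnn //=; congr (_ + _)%N.
    rewrite mulnC -sum_nat_cond_const; apply: eq_big => j.
    - case: (boolP (w j %| s)%N) => [/(dvdn_leq s_gt0) le_ws|nws].
        by rewrite -val_eqE /= inordK // andbT.
      rewrite andbF /=; apply/esym/negP => /andP[_ /eqP E].
      by rewrite E dvdnn in nws.
    - by move=> /andP[/andP[_ /(dvdn_leq s_gt0) ?]];
        rewrite -val_eqE /= inordK // => /eqP.
  rewrite big_mkcond [RHS]big_mkcond big_ord_recr /= eqxx andbF addn0.
  apply: eq_bigr => d _.
  have -> /= : widen_ord (leqnSn s) d != ord_max.
    by rewrite -val_eqE /= ltn_eqF.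
  rewrite andbT; case: ifP => // ds.
  rewrite mulnC -sum_nat_cond_const; apply: eq_big => j.
    case: (boolP (w j %| s)%N) => [/(dvdn_leq s_gt0) le_ws|nws].
      by rewrite -val_eqE /= inordK // andbT.
    rewrite andbF /=; apply/esym/negP => /andP[_ /eqP E].
    by rewrite E ds in nws.
  by move=> /andP[/andP[_ /(dvdn_leq s_gt0) ?]];
    rewrite -val_eqE /= inordK // => /eqP.
by move=> j /andP[_ ws]; rewrite inordK // ltnS dvdn_leq.
Qed.

(* The sums [sum_(w j | s) w j] determine the number of atoms of each weight. *)
Lemma eq_fps_prod_ghost (P : pred nat) : P 0%N ->
  {in S1, forall j, 0 < w1 j}%N -> {in S2, forall j, 0 < w2 j}%N ->
  (forall s, (0 < s <= n)%N ->
    \sum_(j in S1 | (w1 j %| s)%N) w1 j =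
      \sum_(j in S2 | (w2 j %| s)%N) w2 j)%N ->
  (\big[fps_mul/fps_one]_(j in S1) fps_subst (w1 j) (fps_ind P)) n =
  (\big[fps_mul/fps_one]_(j in S2) fps_subst (w2 j) (fps_ind P)) n.
Proof.
move=> P0 w1_gt0 w2_gt0 gh.
have cardE s : (0 < s <= n)%N ->
    #|[set j in S1 | w1 j == s]| = #|[set j in S2 | w2 j == s]|.
  (* By strong induction the contributions of the smaller divisors agree and cancel. The induction
     hypothesis says nothing about d = 0, but that term carries the factor 0. *)
  elim/ltn_ind: s => s IH /andP[s_gt0 le_sn]; have := gh s.
  rewrite s_gt0 le_sn => /(_ isT); rewrite !ghost_split //.
  rewrite (eq_bigr (fun d : 'I_s => d * #|[set j in S2 | w2 j == d]|)%N);
    last first.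
    move=> d ds; case: (posnP d) => [->|d_gt0]; first by rewrite !mul0n.
    by rewrite IH // d_gt0 (leq_trans (ltnW (ltn_ord d)) le_sn).
  by move/addIn/eqP; rewrite eqn_pmul2l // => /eqP.
have prodE (J : finType) (S : {set J}) (w : J -> nat) :
    {in S, forall j, 0 < w j}%N ->
    (\big[fps_mul/fps_one]_(j in S) fps_subst (w j) (fps_ind P)) n =
    (\big[fps_mul/fps_one]_(d < n.+1 | (0 < d)%N)
        iter #|[set j in S | w j == d]|
          (fps_mul (fps_subst d (fps_ind P))) fps_one) n.
  move=> w_gt0.
  rewrite (bigID (fun j => w j <= n)%N) /=.
  rewrite (fps_mulC _ (\big[_/_]_(_ in _ | ~~ _) _)).
  set A := (X in fps_mul _ X); set B := (X in fps_mul X _).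
  (* A factor of weight above n is 1 modulo x^(n+1), its constant term being 1 by [P0]. *)
  have EB k : (k <= n)%N -> B k = fps_one k.
    move=> le_kn; transitivity
      ((\big[fps_mul/fps_one]_(j in S | ~~ (w j <= n)%N) fps_one) k).
      apply: (@fps_prod_congr n) le_kn => j {}k /andP[jS].
      rewrite -ltnNge => lt_nw le_kn.
      rewrite /fps_subst /fps_ind /fps_one; case: (posnP k) => [->|k_gt0].
        by rewrite dvdn0 div0n P0.
      case: ifP => // /(dvdn_leq k_gt0) le_wk.
      by have := leq_ltn_trans (leq_trans le_wk le_kn) lt_nw; rewrite ltnn.
    by rewrite big1.
  have -> : fps_mul B A n = A n.
    rewrite -[in RHS](fps_mul1 A) /fps_mul; apply: eq_bigr => i _.
    by rewrite EB // -ltnS.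
  congr (_ n); rewrite /A.
  rewrite (partition_big (fun j => inord (w j) : 'I_n.+1) (fun d => 0 < d)%N)
    /=.
    apply: eq_bigr => d d_gt0; rewrite -big_const; apply: eq_big => j.
      rewrite !inE -andbA; case jS: (j \in S) => //=.
      case: (leqP (w j) n) => [le_wn|lt_nw] /=.
        by rewrite -val_eqE /= inordK.
      by apply/esym/negbTE; rewrite gtn_eqF // (leq_trans _ lt_nw) // ltn_ord.
    by move=> /andP[/andP[_ ?]]; rewrite -val_eqE /= inordK // => /eqP->.
  by move=> j /andP[jS le_wn]; rewrite inordK // w_gt0.
rewrite !prodE //; congr (_ n); apply: eq_bigr => d d_gt0.
by rewrite cardE // d_gt0 -ltnS ltn_ord.
Qed.

End Ghost.

(** * Invariant multisets of two commuting permutations *)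

Lemma card_porbit_dvdn (T : finType) (t : {perm T}) (x : T) (k : nat) :
  (#|porbit t x| %| k)%N = ((t ^+ k)%g x == x).
Proof.
set c := #|porbit t x|.
have c_gt0 : (0 < c)%N by rewrite lt0n; apply/eqP => /card0_eq/(_ x);
  rewrite porbit_id.
have tc m : (t ^+ (m * c))%g x = x.
  have tc1 : (t ^+ c)%g x = x by rewrite permX iter_porbit.
  by elim: m => [|m IH]; rewrite ?perm1 // mulSn expgD permM tc1.
rewrite /dvdn {2}(divn_eq k c) addnC expgD permM.
have -> : (t ^+ (k %/ c * c))%g ((t ^+ (k %% c))%g x) = (t ^+ (k %% c))%g x.
  by rewrite -permM -expgD addnC expgD permM tc.
have lt_kc := ltn_pmod k c_gt0; set m := (k %% c)%N in lt_kc *.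
apply/eqP/eqP => [->|tm]; first by rewrite perm1.
have := uniq_traject_porbit t x; rewrite -/c => U.
have : nth x (traject t x c) m = nth x (traject t x c) 0.
  by rewrite !nth_traject // -permX tm.
by move/eqP; rewrite nth_uniq ?size_traject // => /eqP.
Qed.

Lemma mem_permX (T : finType) (t : {perm T}) (D : {set T}) i x :
  (forall y, (t y \in D) = (y \in D)) -> ((t ^+ i)%g x \in D) = (x \in D).
Proof.
by move=> tD; elim: i x => [|i IH] x; rewrite ?perm1 // expgSr permM tD IH.
Qed.

Section Dynamics.

Variables (T : finType) (s g : {perm T}) (D : {set T}) (e : nat).
Hypothesis sg : commute s g.
Hypotheses (sD : forall x, (s x \in D) = (x \in D)).
Hypotheses (gD : forall x, (g x \in D) = (x \in D)).
Hypotheses (e_gt0 : (0 < e)%N) (card_gD : {in D, forall x, #|porbit g x| = e}).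

Definition block_perm : {perm {set T}} := perm (imset_inj (@perm_inj _ s)).

(* The orbit of [x] under the group generated by [s] and [g], encoded as the  *)
(* orbit under [s] of the [g]-orbit of [x].                                   *)
Definition atom (x : T) : {set {set T}} := porbit block_perm (porbit g x).

Lemma commute_sXgX i j x : (s ^+ i)%g ((g ^+ j)%g x) =
  (g ^+ j)%g ((s ^+ i)%g x).
Proof. by rewrite -!permM; congr (fun_of_perm _ x); apply/esym/commuteX2. Qed.

Lemma block_permX t x :
  (block_perm ^+ t)%g (porbit g x) = porbit g ((s ^+ t)%g x).
Proof.
elim: t x => [|t IH] x; first by rewrite !perm1.
rewrite !expgS !permM -IH; congr (fun_of_perm _ _); rewrite permE.
apply/setP => y; apply/imsetP/porbitP => [[_ /porbitP[i ->] ->]|[i ->]].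
  by exists i; have := commute_sXgX 1 i x; rewrite !expg1.
exists ((g ^+ i)%g x); first exact: mem_porbit.
by have := commute_sXgX 1 i x; rewrite !expg1.
Qed.

Lemma atomP x y :
  reflect (exists i j, y = (g ^+ j)%g ((s ^+ i)%g x)) (atom y == atom x).
Proof.
rewrite eq_porbit_mem; apply: (iffP (porbitP _ _ _)) => [[i]|[i [j ->]]].
  rewrite block_permX => /eqP; rewrite eq_porbit_mem => /porbitP[j ->].
  by exists i, j.
exists i; rewrite block_permX; apply/eqP.
by rewrite eq_porbit_mem mem_porbit.
Qed.

(** The orbit of x under both permutations is the disjoint union of the [g]-orbits that make up
    [atom x], each with e elements. *)
Lemma card_atom x : x \in D ->
  #|[set y in D | atom y == atom x]| = (e * #|atom x|)%N.
Proof.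
move=> xD; rewrite mulnC; apply: card_uniform_partition.
  by move=> _ /porbitP[i ->]; rewrite block_permX card_gD // mem_permX.
apply/and3P; split.
- apply/eqP/setP => y; rewrite inE; apply/bigcupP/idP.
    case=> _ /porbitP[i ->]; rewrite block_permX => /porbitP[j ->].
    by rewrite !mem_permX // xD; apply/atomP; exists i, j.
  case/andP=> yD /atomP[i [j ->]]; exists (porbit g ((s ^+ i)%g x)).
    by rewrite -block_permX mem_porbit.
  exact: mem_porbit.
- apply/finset.trivIsetP => _ _ /porbitP[i ->] /porbitP[j ->].
  rewrite !block_permX => neq; rewrite -setI_eq0; apply/set0Pn => -[y].
  rewrite inE -!eq_porbit_mem => /andP[/eqP E1 /eqP E2].
  by rewrite -E1 -E2 eqxx in neq.
- apply/negP => /porbitP[i]; rewrite block_permX => /setP/(_ ((s ^+ i)%g x)).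
  by rewrite inE porbit_id.
Qed.

(** The left side counts the points whose block has size dividing k. By [card_atom] that size is e
    times the period of the [g]-orbit of x under [s], so the condition is that e divides k and that
    [s ^+ (k %/ e)] maps x into its own [g]-orbit. *)
Lemma ghost_atom (k : nat) :
  (\sum_(a in atom @: D | #|[set x in D | atom x == a]| %| k)
     #|[set x in D | atom x == a]| =
   if e %| k then #|[set x in D | (s ^+ (k %/ e))%g x \in porbit g x]| else
     0)%N.
Proof.
pose w a := #|[set x in D | atom x == a]|; rewrite -/w.
transitivity #|[set x in D | (w (atom x) %| k)%N]|.
  rewrite -[RHS]sum1_card
    (partition_big atom (fun a => (a \in atom @: D) && (w a %| k)%N)) /=.
    apply: eq_bigr => a /andP[aD ak]; rewrite /w -sum1_card; apply: eq_bigl =>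
      x.
    rewrite !inE; case: eqP => [->|]; last by rewrite !andbF.
    by rewrite ak !andbT.
  by move=> x; rewrite inE => /andP[xD ->]; rewrite imset_f.
case: ifPn => [/dvdnP[m ->]|nek].
  rewrite mulnK //; apply: eq_card => x; rewrite !inE; case xD: (x \in D) =>
    //=.
  rewrite /w card_atom // mulnC dvdn_pmul2r // card_porbit_dvdn block_permX.
  exact: eq_porbit_mem.
apply/eqP; rewrite cards_eq0; apply/eqP/setP => x; rewrite !inE.
apply/negP => /andP[xD]; rewrite /w card_atom // => h; case/negP: nek.
by apply: dvdn_trans h; apply: dvdn_mulr.
Qed.

(** Invariance under both permutations is the same as being constant on atoms, so
    [card_atom_functions] applies. *)
Lemma card_invariant (P : pred nat) (n : nat) : P 0%N ->
  #|[set m : {ffun T -> 'I_n.+1} |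
      [&& [forall x, (x \notin D) ==> (m x == 0%N :> nat)],
          [forall x, m (s x) == m x], [forall x, m (g x) == m x],
          [forall x, P (m x)] & (\sum_x m x == n)%N]]|%:R =
  (\big[fps_mul/fps_one]_(a in atom @: D)
     fps_subst #|[set x in D | atom x == a]| (fps_ind P)) n.
Proof.
move=> P0; rewrite -card_atom_functions //; congr _%:R; apply: eq_card => m.
rewrite !inE; case: forallP => //= suppm; rewrite andbA; congr (_ && _).
apply/andP/forall_inP => [[/forallP sm /forallP gm] x xD|cst].
  apply/forall_inP => y yD; apply/implyP => /atomP[i [j ->]].
  have -> : m ((g ^+ j)%g ((s ^+ i)%g y)) = m ((s ^+ i)%g y).
    by elim: j => [|j IH]; rewrite ?perm1 // expgSr permM (eqP (gm _)).
  by elim: i => [|i IH]; rewrite ?perm1 // expgSr permM (eqP (sm _)).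
have mD0 x y : x \notin D -> y \notin D -> m x == m y.
  move=> xD yD; apply/eqP/val_inj => /=; move/implyP/(_ xD)/eqP: (suppm x) =>
    ->.
  by move/implyP/(_ yD)/eqP: (suppm y) => ->.
split; apply/forallP => x; have [xD|xD] := boolP (x \in D).
- have /forall_inP/(_ x xD)/implyP := cst (s x) (etrans (sD x) xD).
  by apply; apply/atomP; exists 1%N, 0%N; rewrite perm1 expg1.
- by apply: mD0; rewrite ?sD.
- have /forall_inP/(_ x xD)/implyP := cst (g x) (etrans (gD x) xD).
  by apply; apply/atomP; exists 0%N, 1%N; rewrite perm1 expg1.
- by apply: mD0; rewrite ?gD.
Qed.

End Dynamics.

(** * Stable sets and multisets as multiplicity functions *)

Lemma ncard_imset (I : finType) (T : choiceType) (F : {set I}) (h : I -> T)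
    (A : set T) : {in F &, injective h} ->
  (forall y, A y <-> exists2 x, x \in F & h x = y) ->
  finite_set A /\ ncard A = #|F|.
Proof.
move=> injh hA; have AE : A = [set` [fset h x | x in F]%fset]%classic.
  apply/seteqP; split => y /=.
    by case/hA => x xF <-; apply/imfsetP; exists x.
  by case/imfsetP => x /= xF ->; apply/hA; exists x.
split; first by rewrite AE.
by rewrite /ncard AE set_fsetK card_in_imfset //= ?cardE.
Qed.

Lemma mset_map_comp (T : choiceType) (f g : T -> T) (S : {mset T}%mset) :
  mset_map f (mset_map g S) = mset_map (f \o g) S.
Proof.
apply/eq_seq_msetP; rewrite (map_comp f g); apply: perm_map.
exact: perm_eq_seq_mset.
Qed.

Lemma mset_map_id (T : choiceType) (S : {mset T}%mset) : mset_map id S = S.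
Proof. by rewrite /mset_map map_id seq_mset_id. Qed.

Lemma fset_map_comp (T : choiceType) (f g : T -> T) (S : {fset T}) :
  fset_map f (fset_map g S) = fset_map (f \o g) S.
Proof.
apply/fsetP => x; apply/imfsetP/imfsetP =>
  /= [[_ /imfsetP[y yS ->] ->]|[y yS ->]].
  by exists y.
by exists (g y) => //; apply/imfsetP; exists y.
Qed.

Lemma fset_map_id (T : choiceType) (S : {fset T}) : fset_map id S = S.
Proof.
by apply/fsetP => p; apply/imfsetP/idP => [[x /= xS ->] //|pS]; exists p.
Qed.

Section Collections.

Local Open Scope classical_set_scope.

Variables (T : choiceType) (Om : {fset T}) (X : set T) (f g : T -> T) (n : nat).
Variables (s t : {perm Om}).
Hypotheses (inj_f : injective f) (inj_g : injective g).
Hypothesis sE : forall x, val (s x) = f (val x).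
Hypothesis tE : forall x, val (t x) = g (val x).
Hypothesis OmP : forall p, X p ->
  (exists2 j, (0 < j <= n)%N & iter j f p = p) -> p \in Om.

(** Written in the shape of the set counted by [card_invariant]. *)
Definition inv_functions (P : pred nat) : {set {ffun Om -> 'I_n.+1}} :=
  [set m : {ffun Om -> 'I_n.+1} |
    [&& [forall x, (x \notin [set x | `[< X (val x) >]]%SET) ==>
      (m x == 0%N :> nat)],
          [forall x, m (s x) == m x], [forall x, m (t x) == m x],
          [forall x, P (m x)] & (\sum_x m x == n)%N]]%SET.

Definition ext0 (m : {ffun Om -> 'I_n.+1}) (q : T) : nat :=
  oapp (fun x : Om => m x : nat) 0%N (insub q).

(** Treats sets and multisets together: [mu] reads off multiplicities, [mk] rebuilds the collection
    from its multiplicities on [Om], and [P] bounds them. *)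
Lemma card_collections (C : choiceType) (mu : C -> T -> nat)
    (mk : {ffun Om -> 'I_n.+1} -> C) (P : pred nat) (A : set C) :
  P 0%N -> (forall S S', mu S =1 mu S' -> S = S') ->
  (forall m : {ffun Om -> 'I_n.+1}, (forall x, P (m x)) -> mu (mk m) =1 ext0 m)
    ->
  (forall S, A S <->
     [/\ forall p, (0 < mu S p)%N -> p \in Om /\ X p,
         forall x : Om, mu S (f (val x)) = mu S (val x),
         forall x : Om, mu S (g (val x)) = mu S (val x),
         forall p, P (mu S p) &
         (\sum_(x : Om) mu S (val x) = n)%N]) ->
  finite_set A /\ ncard A = #|inv_functions P|.
Proof.
move=> P0 mu_inj muK AE; apply: (@ncard_imset _ _ _ mk).
  move=> m m'; rewrite !inE => /and5P[_ _ _ /forallP Pm _].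
  move=> /and5P[_ _ _ /forallP Pm' _] mm'; apply/ffunP => x; apply: val_inj =>
    /=.
  have := muK m Pm (val x); rewrite mm' muK // /ext0 valK /=.
  by move=> ->.
move=> S; rewrite AE; split=> [[suppS Sf Sg PS sumS]|[m]].
  have Sn (x : Om) : (mu S (val x) < n.+1)%N.
    by rewrite ltnS -[leqRHS]sumS (bigD1 x) //= leq_addr.
  pose m := [ffun x : Om => inord (mu S (val x)) : 'I_n.+1].
  have mE x : m x = mu S (val x) :> nat by rewrite ffunE inordK.
  exists m; last first.
    apply: mu_inj => q; rewrite muK; last by move=> x; rewrite mE.
    rewrite /ext0; case: insubP => [x _ <- /=|qOm /=]; first by rewrite mE.
    by apply/esym/eqP; rewrite eqn0Ngt; apply: contra qOm => /suppS[].
  rewrite inE; apply/and5P; split.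
  - apply/forallP => x; apply/implyP; rewrite inE mE eqn0Ngt.
    by apply: contra => /suppS[_ ?]; apply/asboolP.
  - by apply/forallP => x; apply/eqP/val_inj; rewrite /= !mE sE.
  - by apply/forallP => x; apply/eqP/val_inj; rewrite /= !mE tE.
  - by apply/forallP => x; rewrite mE.
  - by apply/eqP; rewrite -[RHS]sumS; apply: eq_bigr => x _; rewrite mE.
rewrite inE => /and5P[/forallP suppm /forallP ms /forallP mt /forallP Pm /eqP
  summ] <-.
have mE x : mu (mk m) (val x) = m x by rewrite muK // /ext0 valK.
split.
- move=> p; rewrite muK // /ext0; case: insubP => //= x _ <- mx; split;
    first exact: valP.
  have := suppm x; rewrite inE; case: asboolP => //= _ /eqP m0.
  by rewrite m0 in mx.
- by move=> x; rewrite -sE !mE (eqP (ms x)).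
- by move=> x; rewrite -tE !mE (eqP (mt x)).
- by move=> p; rewrite muK // /ext0; case: insubP => /=.
- by rewrite -[RHS]summ; apply: eq_bigr => x _; rewrite mE.
Qed.

Lemma sum_ext0 (S : T -> nat) (A : {fset T}) :
  (forall p, (0 < S p)%N -> p \in A) -> (A `<=` Om)%fset ->
  (\sum_(x : Om) S (val x) = \sum_(p <- A) S p)%N.
Proof.
move=> supp AOm; rewrite -(big_seq_fsetE _ Om predT S) /=.
apply/esym/big_fset_incl => // p _ pA; apply/eqP; rewrite eqn0Ngt.
by apply: contra pA; apply: supp.
Qed.

(** Since f permutes the members of a stable multiset of size n, each member has f-period at most n
    ([iter_periodic]) and so lies in [Om] by [OmP]. This is what reduces the count to functions on a
    finite type. *)
Lemma card_stable_nmsets :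
  let A := [set S | stable_nmsets X f n S /\ mset_map g S = S] in
  finite_set A /\ ncard A = #|inv_functions predT|.
Proof.
move=> A; apply:
  (@card_collections ({mset T}%mset : choiceType)
    (fun (S : {mset T}%mset) p => S p)
  (fun m => [fsfun q in Om => ext0 m q | 0%N] : {mset T}%mset) predT).
- by [].
- by move=> S S' SS'; apply/msetP.
- move=> m _ q; rewrite fsfunE; case: ifP => //.
  by rewrite /ext0; case: insubP => // x ->.
have mapE (h : T -> T) (S : {mset T}%mset) q : injective h ->
  mset_map h S (h q) = S q.
  move=> inj_h; rewrite mset_seqE count_map -count_mem_mset; apply: eq_count =>
    p /=.
  exact: inj_eq.
move=> S; change {mset T}%mset in (type of S).
split=> [[[SX sizeS Sf] Sg]|[suppS Sf Sg _ sumS]].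
  have iterS (p : T) : p \in S -> p \in Om.
    move=> pS; have [|j /andP[j0 jn] jp] :=
      @iter_periodic _ f (S : seq T) p inj_f pS.
      by move=> q; rewrite -!mset_neq0 -{2}Sf mapE.
    by apply: OmP; [exact: SX | exists j => //; rewrite j0 -sizeS].
  split=> //.
  - by move=> p; rewrite mset_gt0 => pS; split; [exact: iterS | exact: SX].
  - by move=> x; rewrite -{1}Sf mapE.
  - by move=> x; rewrite -{1}Sg mapE.
  - rewrite -sizeS size_mset; apply: sum_ext0.
      by move=> p; rewrite mset_gt0 msuppE.
    by apply/fsubsetP => p; rewrite msuppE; apply: iterS.
have mapK (h : T -> T) (u : {perm Om}) : injective h ->
  (forall x, val (u x) = h (val x)) ->
    (forall x : Om, S (h (val x)) = S (val x)) -> mset_map h S = S.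
  move=> inj_h uE Sh; apply/msetP => q.
  have [qOm|qOm] := boolP (q \in Om).
    have -> : q = h (val ((u^-1)%g [` qOm]%fset)) by rewrite -uE permKV.
    by rewrite mapE.
  have -> : S q = 0%N by apply/eqP; rewrite eqn0Ngt; apply: contra qOm =>
    /suppS[].
  apply/eqP; rewrite mset_eq0; apply: contra qOm.
  rewrite (perm_mem (perm_eq_seq_mset _)) => /mapP[p pS ->].
  have pOm : p \in Om by have := suppS p; rewrite mset_gt0 => /(_ pS)[].
  by rewrite -(uE [` pOm]%fset); apply: valP.
split; last exact: mapK tE Sg.
split; last exact: mapK sE Sf.
- by move=> p; rewrite -mset_gt0 => /suppS[].
- rewrite size_mset -sumS; apply/esym/sum_ext0.
    by move=> p; rewrite mset_gt0 msuppE.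
  by apply/fsubsetP => p; rewrite msuppE -mset_gt0 => /suppS[].
Qed.

Lemma card_stable_nsets :
  let A := [set S | stable_nsets X f n S /\ fset_map g S = S] in
  finite_set A /\ ncard A = #|inv_functions (leq^~ 1)|.
Proof.
move=> A; apply:
  (@card_collections ({fset T} : choiceType)
    (fun (S : {fset T}) p => (p \in S) : nat)
          (fun m => [fset q in Om | 0 < ext0 m q]%fset)%N).
- by [].
- move=> S S' SS'; apply/fsetP => p; have := SS' p.
  by do 2 case: (_ \in _).
- move=> m Pm q; rewrite !inE /= /ext0; case: insubP => [x -> _ /=|/negPf-> //].
  by have := Pm x; case: (nat_of_ord (m x)) => [|[]].
have mapE (h : T -> T) (S : {fset T}) q : injective h ->
  (h q \in fset_map h S) = (q \in S).
  by move=> inj_h; rewrite mem_imfset.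
move=> S; change {fset T} in (type of S).
split=> [[[SX sizeS Sf] Sg]|[suppS Sf Sg _ sumS]].
  have iterS (p : T) : p \in S -> p \in Om.
    move=> pS; have [|j /andP[j0 jn] jp] :=
      @iter_periodic _ f (S : seq T) p inj_f pS.
      by move=> q; rewrite -{2}Sf mapE.
    by apply: OmP; [exact: SX | exists j => //; rewrite j0 -sizeS].
  split=> //.
  - by move=> p; rewrite lt0b => pS; split; [exact: iterS | exact: SX].
  - by move=> x; rewrite -{1}Sf mapE.
  - by move=> x; rewrite -{1}Sg mapE.
  - by move=> p; case: (_ \in _).
  - rewrite -sizeS (@sum_ext0 (fun p => (p \in S) : nat) S).
    + rewrite big_seq_cond (eq_bigr (fun=> 1%N)) => [|p /andP[->] //].
      by rewrite -big_seq_cond sum1_size.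
    + by move=> p; rewrite lt0b.
    + by apply/fsubsetP.
have mapK (h : T -> T) (u : {perm Om}) : injective h ->
  (forall x, val (u x) = h (val x)) ->
    (forall x : Om, (h (val x) \in S : nat) = (val x \in S)) ->
      fset_map h S = S.
  move=> inj_h uE Sh; apply/fsetP => q.
  have [qOm|qOm] := boolP (q \in Om).
    have -> : q = h (val ((u^-1)%g [` qOm]%fset)) by rewrite -uE permKV.
    rewrite mapE //; have := Sh ((u^-1)%g [` qOm]%fset).
    by do 2 case: (_ \in _).
  have -> : (q \in S) = false.
    by apply: contraNF qOm => qS; have := suppS q; rewrite lt0b => /(_ qS)[].
  apply: contraNF qOm => /imfsetP[p /= pS ->].
  have pOm : p \in Om by have := suppS p; rewrite lt0b => /(_ pS)[].
  by rewrite -(uE [` pOm]%fset); apply: valP.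
split; last exact: mapK tE Sg.
split; last exact: mapK sE Sf.
- by move=> p pS; have := suppS p; rewrite lt0b => /(_ pS)[].
- rewrite -sumS (@sum_ext0 (fun p => (p \in S) : nat) S).
  + rewrite big_seq_cond (eq_bigr (fun=> 1%N)) => [|p /andP[->] //].
    by rewrite -big_seq_cond sum1_size.
  + by move=> p; rewrite lt0b.
  + by apply/fsubsetP => p pS; have := suppS p; rewrite lt0b => /(_ pS)[].
Qed.

End Collections.

(** * Orbit counting *)

Section Burnside.

Local Open Scope classical_set_scope.

Variables (gT : finGroupType) (T : choiceType) (act : gT -> T -> T) (X : set T).
Hypotheses (finX : finite_set X) (act1 : forall x, act 1%g x = x).
Hypothesis actM : forall a b x, act (a * b)%g x = act b (act a x).
Hypothesis actX : forall a x, X x -> X (act a x).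

(** [Frobenius_Cauchy] is applied to the induced action on the finite type of elements of [X]; the
    orbits there correspond to the classical sets on the left. *)
Lemma burnside :
  (ncard [set range (act^~ x) | x in X] * #|gT| =
   \sum_(a : gT) ncard [set x | X x /\ act a x = x])%N.
Proof.
pose Om := fset_set X.
have OmE (x : T) : (x \in Om) = (x \in X) by rewrite in_fset_set.
have actOm (x : Om) a : act a (val x) \in Om.
  by rewrite OmE inE; apply: actX; have := valP x; rewrite OmE inE.
pose actf (x : Om) (a : gT) : Om := [` actOm x a]%fset.
have actf1 x : actf x 1%g = x by apply: val_inj; rewrite /= act1.
have actfM x : act_morph actf x by move=> a b; apply: val_inj; rewrite /= actM.
pose to := TotalAction actf1 actfM.
have actsT : [acts [set: gT]%SET, on [set: Om]%SET | to]%act.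
  apply/actsP => a _ x; by rewrite !inE.
have := Frobenius_Cauchy actsT; rewrite cardsT => FC.
transitivity (#|orbit to [set: gT]%SET @: [set: Om]%SET| * #|gT|)%N.
  congr (_ * _)%N.
  apply: (proj2 (@ncard_imset _ _ _
    (fun O : {set Om} => [set val x | x in [set y | y \in O]]) _ _ _)).
    move=> A B _ _ AB; apply/setP => x.
    apply/idP/idP => xA.
      have : [set val x | x in [set y | y \in A]] (val x) by exists x.
      by rewrite AB => -[y /= yB /val_inj <-].
    have : [set val x | x in [set y | y \in B]] (val x) by exists x.
    by rewrite -AB => -[y /= yB /val_inj <-].
  have orbE (x : Om) :
    [set val y | y in [set y | y \in orbit to [set: gT]%SET x]] =
      range (act^~ (val x)).
    apply/seteqP; split=> [_ [y /= /orbitP[a _ <-] <-]|_ [a _ <-]] /=;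
      first by exists a.
    by exists (to x a) => //=; apply: mem_orbit; rewrite inE.
  move=> Y; split=> [[x Xx <-]|[O /imsetP[x _ ->] <-]].
    have xOm : x \in Om by rewrite OmE inE.
    by exists (orbit to [set: gT]%SET [` xOm]%fset);
      rewrite ?imset_f ?inE // orbE.
  by rewrite orbE; exists (val x) => //; have := valP x; rewrite OmE inE.
rewrite -FC; apply: eq_big => [a|a _]; first by rewrite inE.
apply/esym/(proj2 (@ncard_imset _ _ _ val _ _ _));
  first by move=> x y _ _ /val_inj.
move=> x; split=> [[Xx ax]|[y /= yF <-]].
  have xOm : x \in Om by rewrite OmE inE.
  exists [` xOm]%fset => //; apply/setIP; split; first by rewrite inE.
  exact/afix1P/val_inj.
split; first by have := valP y; rewrite OmE inE.
by case/setIP: yF => _ /afix1P /(congr1 val).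
Qed.

Lemma ncard_fix_conj a b :
  ncard [set x | X x /\ act (a ^ b)%g x = x] =
    ncard [set x | X x /\ act a x = x].
Proof.
have fin : finite_set [set x | X x /\ act a x = x]
  by apply: sub_finite_set finX => x [].
have -> : [set x | X x /\ act (a ^ b)%g x = x] =
  (act b @` [set x | X x /\ act a x = x]).
  apply/seteqP; split=> [x [Xx xE]|_ [x [Xx xE] <-]] /=; last first.
    by split; [apply: actX | rewrite -actM -conjgC actM xE].
  exists (act b^-1%g x); last by rewrite -actM mulVg act1.
  split; first exact: actX.
  by rewrite -{2}xE -!actM conjgE !mulgA mulgK.
rewrite /ncard fset_set_image // card_imfset //= => x y /(congr1 (act b^-1%g)).
by rewrite -!actM mulgV !act1.
Qed.

End Burnside.

(** The class of c has |G| / |C(c)| elements, and [C] meets every class exactly once. *)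
Lemma sum_classes (gT : finGroupType) (C : {set gT}) (phi : gT -> nat) :
  is_transversal C (classes [set: gT]) [set: gT] ->
  (forall a b, phi (a ^ b)%g = phi a) ->
  ((\sum_a phi a)%N)%:R / #|gT|%:R =
  \sum_(c in C) (#|'C[c]%g|%:R)^-1 * (phi c)%:R :> rat.
Proof.
case/and3P=> partC _ /forall_inP transC phiJ.
have gT_neq0 : #|gT|%:R != 0 :> rat.
  by rewrite pnatr_eq0 -cardsT -lt0n cardG_gt0.
have cardE c : #|gT| = (#|class c [set: gT]| * #|'C[c]%g|)%N.
  by rewrite -index_cent1 finset.setTI mulnC Lagrange ?finset.subsetT // cardsT.
rewrite (eq_bigl (mem [set: gT])) => [|a]; last by rewrite /= inE.
rewrite (set_partition_big _ partC) /= natr_sum mulr_suml.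
rewrite [RHS](partition_big (fun c => class c [set: gT])
  (mem (classes [set: gT]))) /=; last first.
  by move=> c _; apply: mem_classes; rewrite inE.
apply: eq_bigr => B BC.
have /cards1P[c CBc] := transC B BC.
have /setIP[cC cB] : c \in C :&: B by rewrite CBc set11.
have BE : B = class c [set: gT].
  by case/imsetP: BC cB => x _ -> /class_eqP.
rewrite [RHS](big_pred1 c) => [|d /=]; last first.
  apply/andP/eqP => [[dC /eqP dB]|->]; last by rewrite cC BE.
  by apply/set1P; rewrite -CBc inE dC -dB class_refl.
have -> : (\sum_(a in B) phi a = #|B| * phi c)%N.
  rewrite -sum_nat_const; apply: eq_bigr => a; rewrite BE => /imsetP[b _ ->].
  exact: phiJ.
move: gT_neq0; rewrite (cardE c) -BE !natrM mulf_eq0 negb_or => /andP[B0 C0].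
by rewrite invfM mulrACA mulfV // mul1r mulrC.
Qed.

(** * Frobenius and projective transformations acting on subspaces *)

Lemma least_posP (P : nat -> Prop) : (exists2 m, (0 < m)%N & P m) ->
  [/\ (0 < least_pos P)%N, P (least_pos P) &
      forall j, (0 < j)%N -> P j -> (least_pos P <= j)%N].
Proof.
case=> m m_gt0 Pm; have exP : exists m, (0 < m)%N && `[< P m >].
  by exists m; rewrite m_gt0; apply/asboolP.
rewrite /least_pos; case: xgetP => [_ _ //|/(_ (ex_minn exP)) []].
case: ex_minnP => j /andP[j_gt0 /asboolP Pj] minj; split=> // i i_gt0 Pi.
by apply: minj; rewrite i_gt0; apply/asboolP.
Qed.

(** The numbers satisfying [P] are closed under addition and subtraction, so Euclidean division by
    the least positive one leaves remainder 0. *)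
Lemma least_pos_dvd (P : nat -> Prop) : P 0%N -> (exists2 m, (0 < m)%N & P m) ->
  (forall a b, P a -> P b -> P (a + b)%N) ->
  (forall a b, P a -> P (a + b)%N -> P b) ->
  forall m, P m <-> (least_pos P %| m)%N.
Proof.
move=> P0 /least_posP[e_gt0 Pe mine] PD PB; set e :=
  least_pos P in e_gt0 Pe mine *.
have Pme m : P (m * e)%N by elim: m => // m IH; rewrite mulSn; apply: PD.
move=> m; split=> [Pm|/dvdnP[j ->]//].
move: Pm; rewrite {1}(divn_eq m e) => /(PB _ _ (Pme _)) Pr.
rewrite /dvdn; case: posnP => // r_gt0.
by have := mine _ r_gt0 Pr; rewrite leqNgt ltn_mod e_gt0.
Qed.

Lemma iter_inj (T : Type) (f : T -> T) i : injective f -> injective (iter i f).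
Proof. by move=> inj_f; elim: i => // i IH x y /= /inj_f/IH. Qed.

Lemma iter_dvd (T : Type) (f : T -> T) (x : T) : injective f ->
  (exists2 m, (0 < m)%N & iter m f x = x) ->
  forall m, iter m f x = x <-> (least_pos (fun r => iter r f x = x) %| m)%N.
Proof.
move=> inj_f ex_m; apply: least_pos_dvd => // a b.
  by rewrite iterD => Ha ->.
by rewrite iterD => Ha Hab; apply: (iter_inj (i := a) inj_f); rewrite Hab.
Qed.

Lemma eq_dvdn (a b : nat) : (forall m, (a %| m)%N <-> (b %| m)%N) -> a = b.
Proof.
move=> ab; apply/eqP; rewrite eqn_dvd; apply/andP; split.
  exact/(ab b).2/dvdnn.
exact/(ab a).1/dvdnn.
Qed.

Lemma closed_root (K : closedFieldType) (m : nat) (c : K) :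
  (0 < m)%N -> exists x : K, x ^+ m = c.
Proof.
move=> m_gt0; have /closed_rootP[x] : size ('X^m - c%:P : {poly K}) != 1%N.
  by rewrite size_XnsubC // eqSS -lt0n.
by rewrite rootE !hornerE => /eqP; rewrite ?hornerXn => /eqP;
  rewrite subr_eq0 => /eqP; exists x.
Qed.

Section Lines.

Variables (K : fieldType) (vT : vectType K).

Lemma lineZ (c : K) (v : vT) : c != 0 -> <[c *: v]>%VS = <[v]>%VS.
Proof.
move=> c0; apply/eqP; rewrite eqEsubv -!memvE memvZ ?memv_line //=.
by rewrite -[v in v \in _](scalerK c0) memvZ ?memv_line.
Qed.

Lemma eq_lineP (u v : vT) : u != 0 ->
  <[u]>%VS = <[v]>%VS <-> exists2 c, c != 0 & u = c *: v.
Proof.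
move=> u0; split=> [E|[c c0 ->]]; last exact: lineZ.
have /vlineP[c uE] : u \in <[v]>%VS by rewrite -E memv_line.
by exists c => //; apply: contraNneq u0 => c0; rewrite uE c0 scale0r.
Qed.

Lemma dim1_line (V : {vspace vT}) : \dim V = 1%N ->
  exists2 v, v != 0 & V = <[v]>%VS.
Proof.
move=> dV; have V0 : V != 0%VS by rewrite -dimv_eq0 dV.
exists (vpick V); first by rewrite vpick0.
by apply/esym/eqP; rewrite eqEdim -memvE memv_pick dim_vline vpick0 V0 dV.
Qed.

End Lines.

Section FrobeniusAction.

Variables (k : finFieldType) (K : closedFieldType) (iota : {rmorphism k -> K}).
Variable N : nat.

Local Notation q := #|k|.
Local Notation E := 'rV[K]_N.+1.
Local Notation Lin := {vspace 'rV[K]_N.+1}.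
Local Notation frob := (@frob k K N).
Local Notation frob_vec := (@frob_vec k K N).
Local Notation pgl_act := (@pgl_act k K iota N).

Definition pglmx (g : PGL k N) : 'M[K]_N.+1 := map_mx iota (GLval (repr g)).

Let G := pglmx.

Lemma card_k_gt1 : (1 < q)%N.
Proof. exact: finNzRing_gt1. Qed.

Lemma card_k_pchar : exists p j, p \in [pchar K] /\ q = (p ^ j)%N.
Proof.
have [p p_pr chp] := finPcharP k; have := card_pprimeChar chp.
by exists p; eexists; split; last eassumption; rewrite (fmorph_pchar iota).
Qed.

Lemma frobenius_rmorphism s :
  exists Fr : {rmorphism K -> K}, forall x, Fr x = x ^+ (q ^ s).
Proof.
have [p [j [chp ->]]] := card_k_pchar.
rewrite -expnM; elim: (j * s)%N => [|i [Fr FrE]]; first by exists idfun.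
exists (Fr \o pFrobenius_aut chp) => x /=.
by rewrite FrE pFrobenius_autE -exprM -expnS.
Qed.

Lemma pchar_nat_card s : ([pchar K]).-nat (q ^ s)%N.
Proof.
have [p [j [chp ->]]] := card_k_pchar.
by rewrite !pnatX pnatE ?chp //; apply: pcharf_prime chp.
Qed.

Lemma iter_frob_vecE s v : iter s frob_vec v = map_mx (fun x => x ^+ (q ^ s)) v.
Proof.
elim: s => [|s IH] /=; first by apply/rowP => j; rewrite mxE expr1.
by rewrite IH; apply/rowP => j; rewrite !mxE -exprM -expnSr.
Qed.

Lemma frob_vecD u v : frob_vec (u + v) = frob_vec u + frob_vec v.
Proof.
have [Fr FrE] := frobenius_rmorphism 1.
by apply/rowP => j; rewrite !mxE -[q]expn1 -!FrE rmorphD.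
Qed.

Lemma frob_vecZ c v : frob_vec (c *: v) = c ^+ q *: frob_vec v.
Proof. by apply/rowP => j; rewrite !mxE exprMn. Qed.

Lemma iter_frob_vecZ s c v :
  iter s frob_vec (c *: v) = c ^+ (q ^ s) *: iter s frob_vec v.
Proof. by rewrite !iter_frob_vecE; apply/rowP => j; rewrite !mxE exprMn. Qed.

Lemma frob_vec_inj : injective frob_vec.
Proof.
have [Fr FrE] := frobenius_rmorphism 1.
move=> u v uv; apply/rowP => j; move/rowP/(_ j): uv.
by rewrite !mxE -[q]expn1 -!FrE => /fmorph_inj.
Qed.

Lemma frob_vec0 : frob_vec 0 = 0.
Proof. by rewrite -(scale0r (0 : E)) frob_vecZ expr0n gtn_eqF ?scale0r // ltnW
  // card_k_gt1. Qed.

Lemma frob_vec_eq0 v : (frob_vec v == 0) = (v == 0).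
Proof. by rewrite -[RHS](inj_eq frob_vec_inj) frob_vec0. Qed.

Lemma frob_vec_surj v : exists u, frob_vec u = v.
Proof.
have q0 : (0 < q)%N by rewrite ltnW // card_k_gt1.
have root j := cid (closed_root (v 0 j) q0).
by exists (\row_j sval (root j)); apply/rowP => j; rewrite !mxE; case: (root j).
Qed.

Lemma frob_vec_sum (I : Type) (r : seq I) (P : pred I) (F : I -> E) :
  frob_vec (\sum_(i <- r | P i) F i) = \sum_(i <- r | P i) frob_vec (F i).
Proof. by apply: (big_morph frob_vec frob_vecD frob_vec0). Qed.

Lemma expr_iota (x : k) s : iota x ^+ (q ^ s) = iota x.
Proof.
by rewrite -rmorphXn; congr (iota _); elim: s => [|s IH];
  rewrite ?expr1 // expnSr exprM IH expf_card.
Qed.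

Lemma map_mx_frobE s (Fr : {rmorphism K -> K})
  (FrE : forall x, Fr x = x ^+ (q ^ s))
    m n (M : 'M[K]_(m, n)) : map_mx (fun x => x ^+ (q ^ s)) M = map_mx Fr M.
Proof. by apply/matrixP => i j; rewrite !mxE FrE. Qed.

Lemma pglmxX_map s g m : map_mx (fun x => x ^+ (q ^ s)) (G g ^+ m) = G g ^+ m.
Proof.
have [Fr FrE] := frobenius_rmorphism s.
rewrite (map_mx_frobE FrE).
apply: map_mx_fixX; apply/matrixP => i j; rewrite !mxE FrE; exact: expr_iota.
Qed.

Lemma iter_frob_vecM s g m v :
  iter s frob_vec (v *m G g ^+ m) = iter s frob_vec v *m G g ^+ m.
Proof.
rewrite !iter_frob_vecE -{2}(pglmxX_map s g m).
have [Fr FrE] := frobenius_rmorphism s.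
by rewrite !(map_mx_frobE FrE) map_mxM.
Qed.

(** [frob V] is defined as a span. It is the plain image of V because every coefficient has a q-th
    root in K. *)
Lemma mem_frob (V : Lin) v :
  reflect (exists2 u, u \in V & v = frob_vec u) (v \in frob V).
Proof.
apply: (iffP idP) => [|[u uV ->]].
  pose X := [tuple of [seq frob_vec v | v <- vbasis V]].
  rewrite -[frob V]/(<<X>>%VS) => /coord_span ->.
  have q0 : (0 < q)%N by rewrite ltnW // card_k_gt1.
  have root i := cid (closed_root (coord X i v) q0).
  exists (\sum_i sval (root i) *: (vbasis V)`_i).
    by apply: memv_suml => i _; apply/memvZ/vbasis_mem/mem_nth;
      rewrite size_tuple.
  rewrite frob_vec_sum; apply: eq_bigr => i _.
  by rewrite frob_vecZ; case: (root i) => x /= ->;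
    rewrite (nth_map 0) // size_tuple.
rewrite (coord_vbasis uV) frob_vec_sum; apply: memv_suml => i _.
rewrite frob_vecZ; apply/memvZ/memv_span/map_f/mem_nth.
by rewrite size_tuple.
Qed.

Lemma mem_iter_frob s (V : Lin) v :
  reflect (exists2 u, u \in V & v = iter s frob_vec u) (v \in iter s frob V).
Proof.
apply: (iffP idP); elim: s v => [|s IH] v /=; first by exists v.
- by case/mem_frob => w /IH[u uV ->] ->; exists u.
- by case=> u uV ->.
- by case=> u uV ->; apply/mem_frob; exists (iter s frob_vec u) => //;
    apply: IH; exists u.
Qed.

Lemma mem_pgl g (V : Lin) v :
  reflect (exists2 u, u \in V & v = u *m G g) (v \in pgl_act g V).
Proof.
apply: (iffP memv_imgP) => [[u uV ->]|[u uV ->]]; exists u => //.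
  by rewrite lfunE.
by rewrite lfunE.
Qed.

Lemma mem_iter_pgl g i (V : Lin) v :
  reflect (exists2 u, u \in V & v = u *m G g ^+ i) (v \in iter i (pgl_act g) V).
Proof.
apply: (iffP idP); elim: i v => [|i IH] v /=; first by exists v;
  rewrite ?mulmx1.
- by case/mem_pgl => w /IH[u uV ->] ->; exists u; rewrite // exprSr mulmxA.
- by case=> u uV ->; rewrite mulmx1.
- case=> u uV ->; apply/mem_pgl; exists (u *m G g ^+ i);
    last by rewrite exprSr mulmxA.
  by apply: IH; exists u.
Qed.

Lemma iter_frob_line s v : iter s frob <[v]>%VS = <[iter s frob_vec v]>%VS.
Proof.
apply/vspaceP => w; apply/mem_iter_frob/vlineP => [[_ /vlineP[c ->] ->]|[c ->]].
  by exists (c ^+ (q ^ s)); rewrite iter_frob_vecZ.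
have [d <-] : exists d : K, d ^+ (q ^ s) = c.
  by apply: closed_root; rewrite expn_gt0 ltnW // card_k_gt1.
by exists (d *: v); rewrite ?memvZ ?memv_line // iter_frob_vecZ.
Qed.

Lemma iter_pgl_line g i v : iter i (pgl_act g) <[v]>%VS = <[v *m G g ^+ i]>%VS.
Proof.
apply/vspaceP => w; apply/mem_iter_pgl/vlineP => [[_ /vlineP[c ->] ->]|[c ->]].
  by exists c; rewrite scalemxAl.
by exists (c *: v); rewrite ?memvZ ?memv_line // scalemxAl.
Qed.

Lemma frob_sub V W : (frob V <= frob W)%VS = (V <= W)%VS.
Proof.
apply/subvP/subvP => VW v vV.
  have /VW/mem_frob[u uW /frob_vec_inj -> //] : frob_vec v \in frob V.
  by apply/mem_frob; exists v.
by case/mem_frob: vV => u /VW uW ->; apply/mem_frob; exists u.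
Qed.

Lemma iter_frob_sub s V W : (iter s frob V <= iter s frob W)%VS = (V <= W)%VS.
Proof. by elim: s => //= s IH; rewrite frob_sub. Qed.

Lemma frob_inj : injective frob.
Proof. by move=> V W VW; apply/eqP;
  rewrite eqEsubv -frob_sub VW subvv -frob_sub VW subvv. Qed.

Lemma pgl_iter_frob s g V : iter s frob (pgl_act g V) =
  pgl_act g (iter s frob V).
Proof.
apply/vspaceP => v; apply/mem_iter_frob/mem_pgl =>
  [[_ /mem_pgl[u uV ->] ->]|[_ /mem_iter_frob[u uV ->] ->]].
  exists (iter s frob_vec u); first by apply/mem_iter_frob; exists u.
  by have := iter_frob_vecM s g 1 u; rewrite expr1.
exists (u *m G g); first by apply/mem_pgl; exists u.
by have := iter_frob_vecM s g 1 u; rewrite expr1.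
Qed.

Lemma pglmx_unit g : G g \in unitmx.
Proof. by rewrite map_unitmx; apply: valP. Qed.

Lemma pglmxX_unit g i : G g ^+ i \in unitmx.
Proof.
elim: i => [|i IH]; first exact: unitmx1.
by rewrite exprS -mulmxE unitmx_mul pglmx_unit.
Qed.

Lemma pglmx_order g : G g ^+ #|[set: {'GL_N.+1[k]}]| = 1.
Proof.
have GX i : G g ^+ i = map_mx iota (GLval (repr g ^+ i)%g).
  elim: i => [|i IH]; first by rewrite GL_1E map_mx1.
  by rewrite exprS IH expgS GL_ME map_mxM.
rewrite GX; have /eqP-> : (repr g ^+ #|[set: {'GL_N.+1[k]}]|)%g == 1%g.
  by rewrite -order_dvdn order_dvdG ?inE.
by rewrite GL_1E map_mx1.
Qed.

End FrobeniusAction.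

(** * Proper subspaces and hulls of points *)

Section Eigenspaces.

Variables (k : finFieldType) (K : closedFieldType) (iota : {rmorphism k -> K}).
Variable N : nat.

Local Notation E := 'rV[K]_N.+1.
Local Notation Lin := {vspace 'rV[K]_N.+1}.
Local Notation frob := (@frob k K N).
Local Notation pgl_act := (@pgl_act k K iota N).
Local Notation points := (@points K N).
Local Notation G := (@pglmx k K iota N).
Local Notation pexp := (@pexp k K iota N).
Local Notation inv_lin := (@inv_lin k K iota N).
Local Notation proper_lin := (@proper_lin k K iota N).
Local Notation open_part := (@open_part k K iota N).
Local Notation nGL := #|[set: {'GL_N.+1[k]}]|.

Lemma scalar_GL_norm (u : {'GL_N.+1[k]}) : u \in 'N(scalar_GL k N)%g.
Proof.
rewrite inE; apply/fintype.subsetP => _ /imsetP[v vS ->].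
suff -> : (v ^ u = v)%g by [].
apply/conjg_fixP; apply/commgP; apply: val_inj.
move: vS; rewrite inE => /is_scalar_mxP[a av].
rewrite -[LHS]/(GLval _) -[RHS]/(GLval _) !GL_ME av -!mulmxE.
by rewrite mul_scalar_mx mul_mx_scalar.
Qed.

(** [repr] is not multiplicative, but [repr (a * b)] and [repr a * repr b] lie in the same coset of
    the scalar matrices. *)
Lemma pglmxM (a b : PGL k N) : exists2 c : K, c != 0 & G (a * b)%g =
  c *: (G a *m G b).
Proof.
pose ab : PGL k N := (a * b)%g; rewrite -/ab.
have E1 : coset (scalar_GL k N) (repr ab) =
  coset (scalar_GL k N) (repr a * repr b)%g.
  have /= := morphM (coset_morphism (scalar_GL k N))
    (scalar_GL_norm (repr a)) (scalar_GL_norm (repr b)).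
  by move=> ->; rewrite !coset_reprK; exact: (coset_reprK ab).
have := rcoset_kercosetP (scalar_GL_norm (repr ab))
  (scalar_GL_norm (repr a * repr b)%g).
move/introT/(_ E1)/rcosetP => [z zS zE].
move: zS; rewrite inE => /is_scalar_mxP[c cE].
exists (iota c).
  have zU : GLval z \in unitmx by apply: valP.
  apply: contraTneq zU => /eqP; rewrite fmorph_eq0 cE => /eqP->.
  by rewrite unitmxE det_scalar expr0n /= unitr0.
rewrite /pglmx zE !GL_ME cE -!mulmxE !map_mxM map_scalar_mx.
by rewrite mul_scalar_mx.
Qed.

Lemma pgl_actM a b (V : Lin) : pgl_act (a * b)%g V = pgl_act b (pgl_act a V).
Proof.
have [c c0 GE] := pglmxM a b; apply/vspaceP => v.
apply/mem_pgl/mem_pgl => [[u uV ->]|[_ /mem_pgl[u uV ->] ->]].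
  exists ((c *: u) *m G a); last by rewrite -mulmxA GE -scalemxAr scalemxAl.
  by apply/mem_pgl; exists (c *: u) => //; rewrite memvZ.
exists (c^-1 *: u); first by rewrite memvZ.
by rewrite GE -scalemxAr -scalemxAl scalerA mulfV // scale1r mulmxA.
Qed.

Lemma pgl_act_inj g : injective (pgl_act g).
Proof.
move=> V W VW.
suff sub A B : pgl_act g A = pgl_act g B -> (A <= B)%VS.
  by apply/eqP; rewrite eqEsubv (sub _ _ VW) (sub _ _ (esym VW)).
move=> AB; apply/subvP => v vA.
have /mem_pgl[u uB /(congr1 (mulmx^~ (invmx (G g))))] :
  v *m G g \in pgl_act g B.
  by rewrite -AB; apply/mem_pgl; exists v.
by rewrite -!mulmxA mulmxV ?pglmx_unit // !mulmx1 => ->.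
Qed.

Lemma pgl_act1 (V : Lin) : pgl_act 1%g V = V.
Proof. by apply: (@pgl_act_inj 1%g); rewrite -pgl_actM mulg1. Qed.

Lemma pgl_iter g i (V : Lin) : iter i (pgl_act g) V = pgl_act (g ^+ i)%g V.
Proof.
elim: i V => [|i IH] V; first by rewrite pgl_act1.
by rewrite expgS pgl_actM -IH -iterSr.
Qed.

Lemma point_line (p : Lin) : points p -> exists2 v : E, v != 0 & p = <[v]>%VS.
Proof. by case/dim1_line => v v0 ->; exists v. Qed.

Lemma line_point (v : E) : v != 0 -> points <[v]>%VS.
Proof. by rewrite /points /= dim_vline => v0; apply/eqP; rewrite eqb1. Qed.

Lemma pgl_pointsE g p : points (pgl_act g p) <-> points p.
Proof.
have lin (g' : PGL k N) p' : points p' -> points (pgl_act g' p').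
  move=> /point_line[v v0 ->]; have := iter_pgl_line iota g' 1 v => /= ->.
  apply: line_point; apply: contraNneq v0 =>
    /(congr1 (mulmx^~ (invmx (G g' ^+ 1)))).
  by rewrite -mulmxA mulmxV ?pglmxX_unit // mulmx1 mul0mx => ->.
split; last exact: lin.
by move/(lin g^-1%g); rewrite -pgl_actM mulgV pgl_act1.
Qed.

Lemma frob_points p : points p -> points (frob p).
Proof.
move=> /point_line[v v0 ->]; have /= -> := iter_frob_line iota 1 v.
by apply: line_point; rewrite frob_vec_eq0.
Qed.

Definition scalar_on g m (V : Lin) := exists c : K, forall v : E, v \in V ->
  v *m G g ^+ m = c *: v.

Lemma scalar_on_neq0 g m (v : E) c : v != 0 -> v *m G g ^+ m = c *: v -> c != 0.
Proof.
move=> v0 vE; apply: contraNneq v0 => c0; move: vE.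
rewrite c0 scale0r => /(congr1 (mulmx^~ (invmx (G g ^+ m)))).
by rewrite -mulmxA mulmxV ?pglmxX_unit // mulmx1 mul0mx => ->.
Qed.

(** A linear map for which every nonzero vector is an eigenvector is scalar: for independent u and
    v, the eigenvalues of u, v and u + v must coincide. *)
Lemma scalar_onP g m (V : Lin) :
  (forall p, points p -> (p <= V)%VS -> iter m (pgl_act g) p = p) <->
    scalar_on g m V.
Proof.
split=> [fixV|[c cV] _ /point_line[v v0 ->]]; last first.
  rewrite -memvE => vV; rewrite iter_pgl_line cV //; apply: lineZ.
  exact: scalar_on_neq0 v0 (cV v vV).
have eigV (v : E) : v \in V -> v != 0 -> exists c, v *m G g ^+ m = c *: v.
  move=> vV v0; apply/vlineP;
    rewrite -[<[v]>%VS](fixV _ _) ?iter_pgl_line ?memv_line //.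
  exact: line_point.
have [->|V0] := eqVneq V 0%VS.
  by exists 0 => v; rewrite memv0 => /eqP->; rewrite mul0mx scaler0.
have v0 : (vpick V : E) != 0 by move: V0; rewrite -vpick0.
have vV := memv_pick V; move: (vpick V : E) v0 vV => v v0 vV.
have [c vE] := eigV v vV v0; exists c => u uV.
have [/vlineP[a ->]|nuv] := boolP (u \in <[v]>%VS).
  by rewrite -scalemxAl vE !scalerA mulrC.
have u0 : u != 0 by apply: contraNneq nuv => ->; rewrite mem0v.
have [b uE] := eigV u uV u0.
have uv0 : u + v != 0.
  by apply: contraNneq nuv => /eqP; rewrite addr_eq0 => /eqP->;
    rewrite memvN memv_line.
have [d] := eigV (u + v) (memvD uV vV) uv0.
rewrite mulmxDl uE vE scalerDr => /eqP;
  rewrite -subr_eq0 opprD addrACA -!scalerBl.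
have [bd|bd] := eqVneq (b - d) 0.
  rewrite bd scale0r add0r scaler_eq0 (negPf v0) orbF subr_eq0 => /eqP ->.
  by move/eqP: bd; rewrite subr_eq0 => /eqP->.
rewrite addr_eq0 => /eqP h; case/negP: nuv.
by rewrite -[u](scalerK bd) h memvZ // memvN memvZ // memv_line.
Qed.

Lemma scalar_on_GL g V : scalar_on g nGL V.
Proof. by exists 1 => v _; rewrite pglmx_order mulmx1 scale1r. Qed.

Lemma pexp_dvd g V m : scalar_on g m V <-> (pexp g V %| m)%N.
Proof.
rewrite -scalar_onP; apply: (least_pos_dvd (P := fun m => _)) => //.
- exists nGL; first by rewrite cardG_gt0.
  exact/scalar_onP/scalar_on_GL.
- by move=> a b Ha Hb p pp pV; rewrite iterD Hb // Ha.
- move=> a b Ha Hab p pp pV; have := Hab p pp pV.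
  rewrite iterD => E1; apply: (iter_inj (i := a) (@pgl_act_inj g)).
  by rewrite E1 Ha.
Qed.

Lemma pexp_gt0 g V : (0 < pexp g V)%N.
Proof.
have /pexp_dvd := scalar_on_GL g V; apply: contraTltn; rewrite leqn0 => /eqP->.
by rewrite dvd0n -lt0n cardG_gt0.
Qed.

Lemma pexpP g V : scalar_on g (pexp g V) V.
Proof. exact/pexp_dvd. Qed.

Lemma pexp_sub g (V W : Lin) : (V <= W)%VS -> (pexp g V %| pexp g W)%N.
Proof.
by move=> /subvP VW; apply/pexp_dvd; have [c cW] :=
  pexpP g W; exists c => v /VW/cW.
Qed.

Definition eig g m (c : K) : Lin := lker (linfun (mulmxr (G g ^+ m - c%:M))).

Lemma mem_eig g m c v : (v \in eig g m c) = (v *m G g ^+ m == c *: v).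
Proof. by rewrite memv_ker lfunE /= mulmxBr mul_mx_scalar subr_eq0. Qed.

Lemma pgl_invariant g (V : Lin) :
  (forall v, v \in V -> v *m G g \in V) -> pgl_act g V = V.
Proof.
move=> GV; apply/eqP; rewrite eqEdim; apply/andP; split.
  by apply/subvP => v /mem_pgl[u /GV uV ->].
rewrite limg_dim_eq //; apply/eqP; rewrite -subv0; apply/subvP => v.
rewrite memv_cap memv_ker lfunE /= => /andP[_ /eqP].
move=> /(congr1 (mulmx^~ (invmx (G g)))).
by rewrite -mulmxA mulmxV ?pglmx_unit // mulmx1 mul0mx memv0 => ->.
Qed.

Lemma pgl_eig g m c : pgl_act g (eig g m c) = eig g m c.
Proof.
apply: pgl_invariant => v; rewrite !mem_eig => /eqP vE.
by rewrite -mulmxA mulmxE -exprS exprSr -mulmxE mulmxA vE scalemxAl.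
Qed.

Lemma iter_pgl_fix g i (V : Lin) : pgl_act g V = V -> iter i (pgl_act g) V = V.
Proof. by move=> gV; elim: i => //= i ->. Qed.

(** The eigenspace of gamma^(exp V) containing V is invariant, and its exponent divides exp V.
    Properness therefore forbids it to be larger than V. *)
Lemma proper_eig g V : proper_lin g V -> exists c, V = eig g (pexp g V) c.
Proof.
case=> -[V0 gV] maxV; have [c cV] := pexpP g V; exists c.
have VE : (V <= eig g (pexp g V) c)%VS by apply/subvP => v /cV vE;
  rewrite mem_eig vE.
apply/eqP; apply: contraT => neq.
have invE : inv_lin g (eig g (pexp g V) c).
  by split; [apply: contraNneq V0 => h; rewrite h subv0 in VE | exact: pgl_eig].
have := maxV _ invE VE neq; rewrite ltnNge => /negP[].
apply: dvdn_leq; first exact: pexp_gt0.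
by apply/pexp_dvd; exists c => v; rewrite mem_eig => /eqP.
Qed.

(** An invariant W containing V with the same exponent is scalar under gamma^(exp V), with the
    eigenvalue of V, and hence lies in V. *)
Lemma eig_proper g V c : V != 0%VS -> V = eig g (pexp g V) c -> proper_lin g V.
Proof.
move=> V0 VE; split; first by split=> //; rewrite VE pgl_eig.
move=> W _ VW nVW; rewrite ltn_neqAle; apply/andP; split; last first.
  by apply: dvdn_leq; [exact: pexp_gt0 | exact: pexp_sub].
apply: contraNneq nVW => eqe; rewrite eqEsubv VW /=.
have [d dW] := pexpP g W; rewrite -eqe in dW.
have vV := memv_pick V; have v0 : (vpick V : E) != 0 by move: V0;
  rewrite -vpick0.
have cd : c = d.
  have := vV; rewrite {2}VE mem_eig (dW _ (subvP VW _ vV)) => /eqP/eqP.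
  by rewrite -subr_eq0 -scalerBl scaler_eq0 (negPf v0) orbF subr_eq0 => /eqP.
by apply/subvP => w /dW wE; rewrite VE mem_eig wE cd.
Qed.

(** Two eigenspaces of the same power of gamma that share a nonzero vector have the same
    eigenvalue. *)
Lemma proper_eq g (V W p : Lin) : proper_lin g V -> proper_lin g W ->
  pexp g V = pexp g W -> points p -> (p <= V)%VS -> (p <= W)%VS -> V = W.
Proof.
move=> /proper_eig[c VE] /proper_eig[d WE] eVW /point_line[v v0 ->].
rewrite -!memvE VE WE -eVW !mem_eig => /eqP -> .
rewrite -subr_eq0 -scalerBl scaler_eq0 (negPf v0) orbF subr_eq0 => /eqP ->.
by [].
Qed.

(** With e = exp p, which for a point is its gamma-period, V is the eigenspace of gamma^e through
    p. *)
Lemma hull_exists g p : points p ->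
  exists V, [/\ proper_lin g V, (p <= V)%VS & pexp g V = pexp g p].
Proof.
move=> pp; have [c cp] := pexpP g p; set e := pexp g p in cp *.
have pE : (p <= eig g e c)%VS by apply/subvP => v /cp vE; rewrite mem_eig vE.
have eE : pexp g (eig g e c) = e.
  apply/eqP; rewrite eqn_dvd; apply/andP; split; last exact: pexp_sub.
  apply/pexp_dvd; exists c => v.
  by rewrite mem_eig => /eqP.
exists (eig g e c); split=> //; apply: (eig_proper (c := c));
  last by rewrite eE.
apply: contraTneq pE => ->; rewrite subv0 -dimv_eq0.
by rewrite [\dim p]pp.
Qed.

(** If exp V = j * exp W and d is the eigenvalue on W, the common point shows that the eigenvalue on
    V is d^j, and gamma^(exp V) acts on all of W by d^j. *)
Lemma proper_le g (V W p : Lin) : proper_lin g V -> proper_lin g W ->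
  (pexp g W %| pexp g V)%N -> points p -> (p <= V)%VS -> (p <= W)%VS ->
  (W <= V)%VS.
Proof.
move=> /proper_eig[c VE] /proper_eig[d WE] /dvdnP[j eVE] pp pV pW.
have eigX (u : E) b i : u *m G g ^+ pexp g W = b *: u ->
    u *m G g ^+ (i * pexp g W) = b ^+ i *: u.
  move=> uE; elim: i => [|i IH]; first by rewrite mulmx1 scale1r.
  by rewrite mulSn exprD -mulmxE mulmxA uE -scalemxAl IH scalerA -exprS.
have cd : c = d ^+ j.
  have [v v0 vp] := point_line pp; move: pV pW; rewrite vp -!memvE {1}VE {1}WE.
  rewrite !mem_eig => /eqP + /eqP/eigX-/(_ j); rewrite -eVE => ->.
  move/eqP; rewrite -subr_eq0 -scalerBl scaler_eq0 (negPf v0) orbF.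
  by rewrite subr_eq0 => /eqP.
apply/subvP => w; rewrite {1}WE VE !mem_eig => /eqP/eigX-/(_ j).
by rewrite -eVE cd => ->.
Qed.

(** By [proper_le] the subspace of [hull_exists] lies in V, so a point of V^0 has V itself as that
    subspace. Conversely, a proper W strictly below V has smaller exponent, so it contains no point
    of exponent exp V. *)
Lemma open_partP g V p : proper_lin g V -> (p <= V)%VS -> points p ->
  open_part g V p <-> pexp g V = pexp g p.
Proof.
move=> prV pV pp; split=> [[_ _ openV]|eVp].
  have [W [prW pW eWp]] := hull_exists g pp.
  have WV : (W <= V)%VS.
    by apply: (proper_le prV prW _ pp pV pW); rewrite eWp pexp_sub.
  have [<- //|nWV] := eqVneq W V.
  by case/negP: (openV W prW WV nWV).
split=> // W prW WV nWV; apply/negP => pW.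
have [[invV _] [_ maxW]] := (prV, prW).
have := maxW V invV WV nWV; rewrite eVp ltnNge => /negP[].
by apply: dvdn_leq; rewrite ?pexp_gt0 ?pexp_sub.
Qed.

End Eigenspaces.

Section Hulls.

Variables (k : finFieldType) (K : closedFieldType) (iota : {rmorphism k -> K}).
Variable N : nat.

Local Notation q := #|k|.
Local Notation E := 'rV[K]_N.+1.
Local Notation Lin := {vspace 'rV[K]_N.+1}.
Local Notation frob := (@frob k K N).
Local Notation pgl_act := (@pgl_act k K iota N).
Local Notation points := (@points K N).
Local Notation G := (@pglmx k K iota N).
Local Notation pexp := (@pexp k K iota N).
Local Notation proper_lin := (@proper_lin k K iota N).
Local Notation open_part := (@open_part k K iota N).
Local Notation nGL := #|[set: {'GL_N.+1[k]}]|.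
Local Notation scalar_on := (@scalar_on k K iota N).
Local Notation eig := (@eig k K iota N).
Local Notation pdeg := (@pdeg k K N).
Local Notation frob_orbit := (@frob_orbit k K N).
Local Notation nodes := (@nodes k K iota N).
Local Notation node_rep := (@node_rep K N).

(** The default 0 is never taken when p is a point. *)
Definition hull (g : PGL k N) (p : Lin) : Lin :=
  xget 0%VS [set V | proper_lin g V /\ open_part g V p]%classic.

Lemma hullP g p : points p ->
  [/\ proper_lin g (hull g p), (p <= hull g p)%VS & pexp g (hull g p) =
    pexp g p].
Proof.
move=> pp; have [V [prV pV eV]] := hull_exists iota g pp; rewrite /hull.
case: xgetP => [W _ [prW oW]|/(_ V) []]; last by split=> //; apply/open_partP.
have pW : (p <= W)%VS by case: oW.
by split=> //; apply/(open_partP prW pW pp).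
Qed.

Lemma hull_unique g V p : points p -> proper_lin g V -> (p <= V)%VS ->
  pexp g V = pexp g p -> hull g p = V.
Proof.
move=> pp prV pV eV; have [prH pH eH] := hullP g pp.
by apply: proper_eq prH prV _ pp pH pV; rewrite eH.
Qed.

Lemma open_part_hull g V p : proper_lin g V ->
  open_part g V p <-> points p /\ hull g p = V.
Proof.
move=> prV; split=> [opV|[pp <-]].
  have [pp pV _] := opV; split=> //; apply: hull_unique => //.
  exact/open_partP.
have [prH pH eH] := hullP g pp.
exact/open_partP.
Qed.

(** The hull is the least proper subspace through p. *)
Lemma hull_sub g V p : points p -> proper_lin g V -> (p <= V)%VS ->
  (hull g p <= V)%VS.
Proof.
move=> pp prV pV; have [prH pH eH] := hullP g pp.
by apply: (proper_le prV prH _ pp pV pH); rewrite eH pexp_sub.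
Qed.

Lemma scalar_on_frob g m V : scalar_on g m (frob V) <-> scalar_on g m V.
Proof.
split=> [[c cV]|[c cV]].
  have q0 : (0 < q)%N by rewrite ltnW // card_k_gt1.
  have [d dc] := closed_root c q0; exists d => v vV;
    apply: (@frob_vec_inj k K iota N).
  have /= -> := iter_frob_vecM iota 1 g m v.
  by rewrite frob_vecZ dc cV //; apply/(mem_frob iota); exists v.
exists (c ^+ q) => _ /(mem_frob iota)[u uV ->].
by have /= <- := iter_frob_vecM iota 1 g m u; rewrite cV // frob_vecZ.
Qed.

Lemma pexp_frob g V : pexp g (frob V) = pexp g V.
Proof. by apply: eq_dvdn => m; rewrite -!pexp_dvd scalar_on_frob. Qed.

Lemma pexp_iter_frob g i V : pexp g (iter i frob V) = pexp g V.
Proof. by elim: i => //= i IH; rewrite pexp_frob. Qed.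

Lemma frob0 V : (frob V == 0%VS) = (V == 0%VS).
Proof.
have f0 : frob 0%VS = 0%VS.
  apply/eqP; rewrite -subv0; apply/subvP => v /(mem_frob iota)[u].
  by rewrite memv0 => /eqP-> ->; rewrite frob_vec0 mem0v.
by rewrite -{1}f0 (inj_eq (@frob_inj k K iota N)).
Qed.

(** The matrix of gamma has entries in k, so Frobenius maps its eigenspaces for c onto those for
    c^q. *)
Lemma proper_frob g V : proper_lin g V -> proper_lin g (frob V).
Proof.
move=> prV; have [[V0 _] _] := prV; have [c VE] := proper_eig prV.
apply: (eig_proper (c := c ^+ q)); first by rewrite frob0.
rewrite pexp_frob; apply/vspaceP => v; rewrite mem_eig.
apply/(mem_frob iota)/eqP => [[u + ->]|].
  rewrite {1}VE mem_eig => /eqP uE; have /= <- :=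
    iter_frob_vecM iota 1 g (pexp g V) u.
  by rewrite uE frob_vecZ.
have [u <-] := frob_vec_surj k v.
have /= <- := iter_frob_vecM iota 1 g (pexp g V) u.
rewrite -frob_vecZ => /(frob_vec_inj iota) uE; exists u => //.
by rewrite VE mem_eig uE.
Qed.

Lemma proper_iter_frob g i V : proper_lin g V -> proper_lin g (iter i frob V).
Proof. by move=> prV; elim: i => //= i; apply: proper_frob. Qed.

Lemma iter_frob_points i p : points p -> points (iter i frob p).
Proof. by move=> pp; elim: i => //= i; apply: (frob_points iota). Qed.

Lemma hull_frob g p : points p -> hull g (frob p) = frob (hull g p).
Proof.
move=> pp; have [prH pH eH] := hullP g pp.
apply: hull_unique;
  [exact: (frob_points iota) | exact: proper_frob | | by rewrite !pexp_frob].
by rewrite (frob_sub iota).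
Qed.

Lemma hull_iter_frob g i p : points p -> hull g (iter i frob p) =
  iter i frob (hull g p).
Proof.
by move=> pp; elim: i => //= i IH; rewrite hull_frob ?IH //;
  apply: iter_frob_points.
Qed.

Lemma pexp_pgl g V : pexp g (pgl_act g V) = pexp g V.
Proof.
apply: eq_dvdn => m; rewrite -!pexp_dvd.
have GC (u : E) : u *m G g *m G g ^+ m = u *m G g ^+ m *m G g.
  by rewrite -!mulmxA !mulmxE -exprS exprSr.
split=> [[c cV]|[c cV]]; exists c.
  move=> v vV; have : v *m G g \in pgl_act g V by apply/mem_pgl; exists v.
  move/cV; rewrite GC scalemxAl => /(congr1 (mulmx^~ (invmx (G g)))).
  by rewrite -[LHS]mulmxA -[RHS]mulmxA !mulmxV ?pglmx_unit // !mulmx1.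
by move=> _ /mem_pgl[u uV ->]; rewrite GC cV // scalemxAl.
Qed.

Lemma pgl_sub g (V W : Lin) : (V <= W)%VS -> (pgl_act g V <= pgl_act g W)%VS.
Proof.
move=> /subvP VW; apply/subvP => v /mem_pgl[u /VW uW ->].
by apply/mem_pgl; exists u.
Qed.

Lemma hull_pgl g p : points p -> hull g (pgl_act g p) = hull g p.
Proof.
move=> pp; have [prH pH eH] := hullP g pp.
apply: hull_unique => //; first exact/pgl_pointsE.
  by have [[_ <-] _] := prH; apply: pgl_sub.
by rewrite pexp_pgl.
Qed.

Lemma pgl_iter_points g i p : points (iter i (pgl_act g) p) <-> points p.
Proof. by elim: i => //= i IH; rewrite pgl_pointsE. Qed.

Lemma hull_iter_pgl g i p : points p -> hull g (iter i (pgl_act g) p) =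
  hull g p.
Proof.
by move=> pp; elim: i => //= i IH; rewrite hull_pgl // pgl_iter_points.
Qed.

(** A proper subspace is determined by its exponent, a divisor of |GL|, and by its eigenvalue, which
    is a |GL|-th root of unity since the matrix has order dividing |GL|. *)
Lemma proper_lin_seq g : exists s : seq Lin, forall V, proper_lin g V ->
  V \in s.
Proof.
have m_gt0 : (0 < nGL)%N by rewrite cardG_gt0.
have [rs def_P] := closed_field_poly_normal ('X^nGL - 1 : {poly K}).
exists [seq eig g e c | e <- seq.iota 0 nGL.+1, c <- rs] => V prV.
have [c VE] := proper_eig prV; rewrite VE; apply: allpairs_f.
  rewrite mem_iota /= add0n ltnS; apply: dvdn_leq => //.
  exact/pexp_dvd/scalar_on_GL.
have [[V0 _] _] := prV.
have vV := memv_pick V; have v0 : (vpick V : E) != 0 by move: V0;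
  rewrite -vpick0.
move: (vpick V : E) v0 vV => v v0; rewrite VE mem_eig => /eqP vE.
have vX i : v *m G g ^+ (i * pexp g V) = c ^+ i *: v.
  elim: i => [|i IH]; first by rewrite mulmx1 scale1r.
  by rewrite mulSn exprD -mulmxE mulmxA vE -scalemxAl IH scalerA -exprS.
have := vX nGL; rewrite mulnC exprM.
have -> : (G g ^+ pexp g V) ^+ nGL = 1 by rewrite exprAC pglmx_order expr1n.
rewrite mulmx1 -{1}[v]scale1r => /eqP;
  rewrite -subr_eq0 -scalerBl scaler_eq0 (negPf v0) orbF.
rewrite subr_eq0 eq_sym => /eqP c1.
have : root ('X^nGL - 1) c by rewrite rootE !hornerE ?hornerXn c1 subrr.
rewrite def_P rootZ ?root_prod_XsubC // lead_coef_eq0.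
by rewrite -size_poly_eq0 -polyC1 size_XnsubC.
Qed.

Lemma proper_lin_finite g : finite_set (proper_lin g).
Proof.
have [s sP] := proper_lin_seq g.
apply: (@sub_finite_set _ _ [set` [fset V in s]%fset]); last exact: finite_fset.
by move=> V /sP Vs /=; rewrite inE.
Qed.

Lemma nodes_finite g : finite_set (nodes g).
Proof. exact/finite_image/proper_lin_finite. Qed.

Lemma proper_periodic g V : proper_lin g V ->
  exists2 r, (0 < r)%N & iter r frob V = V.
Proof.
move=> prV; have fin := proper_lin_finite g.
have [||r /andP[r_gt0 _] rV] :=
  @iter_periodic _ frob (fset_set (proper_lin g)) V (@frob_inj k K iota N).
- by rewrite in_fset_set // inE.
- by move=> W; rewrite !in_fset_set // !inE; apply: proper_frob.
- by exists r.
Qed.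

Lemma pdeg_gt0 g V : proper_lin g V -> (0 < pdeg V)%N.
Proof. by move=> /proper_periodic/least_posP[]. Qed.

Lemma pdeg_dvd g V j : proper_lin g V -> iter j frob V = V <-> (pdeg V %| j)%N.
Proof. by move=> /proper_periodic exr; apply: iter_dvd => //;
  apply: (@frob_inj k K iota N). Qed.

Lemma frob_orbit_self V : frob_orbit V V.
Proof. by exists 0. Qed.

Lemma frob_orbitP g V W : proper_lin g V -> frob_orbit V W <->
  exists2 j, (j < pdeg V)%N & W = iter j frob V.
Proof.
move=> prV; split=> [[j _ <-]|[j _ ->]]; last by exists j.
exists (j %% pdeg V)%N; first by rewrite ltn_mod (pdeg_gt0 prV).
rewrite {1}(divn_eq j (pdeg V)) addnC iterD.
by have -> : iter (j %/ pdeg V * pdeg V) frob V = V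
  by apply/(pdeg_dvd _ prV)/dvdn_mull.
Qed.

(** Forward iterates already form a full orbit, because a proper V is periodic under Frobenius. *)
Lemma frob_orbit_eq g V W : proper_lin g V -> frob_orbit V W ->
  frob_orbit W = frob_orbit V.
Proof.
move=> prV [i _ WE]; have [r r_gt0 rV] := proper_periodic prV.
have rV' j : iter (j * r) frob V = V.
  by elim: j => // j IH; rewrite mulSn iterD IH.
apply/seteqP; split=> [_ [j _ <-]|_ [j _ <-]].
  by exists (j + i)%N => //; rewrite iterD WE.
have le_i : (i <= i * r)%N by rewrite leq_pmulr.
exists (j + (i * r - i))%N => //.
by rewrite -WE -iterD -addnA subnK // iterD rV'.
Qed.

Lemma node_repP g A : nodes g A ->
  [/\ proper_lin g (node_rep A), A (node_rep A) & A = frob_orbit (node_rep A)].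
Proof.
case=> V prV <-; have : frob_orbit V (node_rep (frob_orbit V)).
  by rewrite /node_rep; apply: (xgetPex 0%VS); exists V; apply: frob_orbit_self.
move=> oV; split=> //; last by rewrite (frob_orbit_eq prV oV).
by case: oV => i _ <-; apply: proper_iter_frob.
Qed.

End Hulls.

(** * Lines fixed up to a projective transformation *)

Section LangLines.

Variables (k : finFieldType) (K : closedFieldType) (iota : {rmorphism k -> K}).
Variable N : nat.

Local Notation q := #|k|.
Local Notation E := 'rV[K]_N.+1.
Local Notation Lin := {vspace 'rV[K]_N.+1}.
Local Notation frob := (@frob k K N).
Local Notation frob_vec := (@frob_vec k K N).
Local Notation pgl_act := (@pgl_act k K iota N).
Local Notation points := (@points K N).
Local Notation G := (@pglmx k K iota N).
Local Notation nGL := #|[set: {'GL_N.+1[k]}]|.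

Lemma card_kX_gt1 M : (0 < M)%N -> (1 < q ^ M)%N.
Proof. by move=> M0; rewrite -(exp1n M) ltn_exp2r // card_k_gt1. Qed.

Lemma fixed_points_finite M : (0 < M)%N ->
  finite_set [set p : Lin | points p /\ iter M frob p = p]%classic.
Proof.
move=> M0; have Q1 := card_kX_gt1 M0.
have [rs [Urs size_rs in_rs]] := roots_frobenius Q1 (pchar_nat_card iota M).
pose f (w : {ffun 'I_N.+1 -> seq_sub rs}) : Lin := <[\row_j ssval (w j)]>%VS.
apply: (@sub_finite_set _ _ (range f)); last exact/finite_image/finite_finset.
move=> p [/point_line[v v0 ->]]; rewrite (iter_frob_line iota) => h.
have Fv0 : iter M frob_vec v != 0.
  by elim: (M) => //= j IH; rewrite frob_vec_eq0.
have [c c0 vE] : exists2 c, c != 0 & iter M frob_vec v = c *: v.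
  exact/(eq_lineP v Fv0).
(* Rescaling as in Hilbert 90: a v is fixed by the Frobenius of q^M elements, so its coordinates lie
   in the field with q^M elements and only finitely many lines arise. *)
have [a aE] : exists a, a ^+ (q ^ M).-1 = c^-1.
  by apply: closed_root; rewrite -ltnS prednK // ltnW.
have a0 : a != 0.
  apply: contraNneq c0 => a0; rewrite a0 expr0n in aE.
  have := aE; rewrite gtn_eqF; last by rewrite -ltnS prednK // ltnW.
  by move/esym/eqP; rewrite invr_eq0.
have avF : iter M frob_vec (a *: v) = a *: v.
  rewrite iter_frob_vecZ vE scalerA -(prednK (ltnW Q1)) exprSr aE mulrAC mulVf
    //.
  by rewrite mul1r.
have mem j : (a *: v) 0 j \in rs.
  rewrite in_rs; apply/eqP; move/rowP/(_ j): avF; rewrite iter_frob_vecE.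
  by rewrite mxE.
exists [ffun j => SeqSub (mem j)] => //; rewrite /f -(lineZ v a0);
  congr (<[_]>)%VS.
by apply/rowP => j; rewrite mxE ffunE.
Qed.

Hypothesis K_alg : forall x : K, algebraicOver iota x.

(** Frobenius permutes the finitely many roots of a polynomial over k that annihilates x. *)
Lemma frobenius_periodic (x : K) : exists2 r, (0 < r)%N & x ^+ (q ^ r) = x.
Proof.
have [P P0 rootP] := K_alg x.
have [rs def_P] := closed_field_poly_normal (map_poly iota P).
have in_rs y : (y \in rs) = root (map_poly iota P) y.
  by rewrite def_P rootZ ?root_prod_XsubC // lead_coef_eq0 map_poly_eq0.
have [Fr FrE] := frobenius_rmorphism iota 1.
have FrP : map_poly Fr (map_poly iota P) = map_poly iota P.
  by apply/polyP => i; rewrite !coef_map /= FrE expr_iota.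
have FrX j y : iter j Fr y = y ^+ (q ^ j).
  by elim: j => [|j IH]; rewrite ?expr1 //= IH FrE expn1 -exprM -expnSr.
have [||r /andP[r0 _]] := @iter_periodic _ Fr rs x (@fmorph_inj _ _ Fr).
- by rewrite in_rs.
- by move=> y; rewrite !in_rs -[in X in _ -> X]FrP => rooty; apply: rmorph_root.
- by rewrite FrX => xE; exists r.
Qed.

Lemma frobenius_periodic_mx m n (A : 'M[K]_(m, n)) :
  exists2 r, (0 < r)%N & forall s, map_mx (fun x => x ^+ (q ^ (r * s))) A = A.
Proof.
pose r i j := sval (cid2 (frobenius_periodic (A i j))).
have r0 i j : (0 < r i j)%N by rewrite /r; case: cid2.
have rE i j : A i j ^+ (q ^ r i j) = A i j by rewrite /r; case: cid2.
exists (\prod_i \prod_j r i j)%N.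
  by apply: prodn_gt0 => i; apply: prodn_gt0 => j.
move=> s; apply/matrixP => i j; rewrite mxE.
have /dvdnP[t ->] : (r i j %| (\prod_i \prod_j r i j) * s)%N.
  rewrite (bigD1 i) //= (bigD1 j) //= -!mulnA; exact: dvdn_mulr.
by elim: t => [|t IH]; rewrite ?expr1 // mulSn expnD exprM rE.
Qed.

Lemma vspace_mx (V : Lin) :
  exists B : 'M[K]_N.+1, forall v : E, (v <= B)%MS = (v \in V).
Proof.
exists (lin1_mx (projv V)) => v; apply/submxP/idP => [[u ->]|vV].
  by rewrite mul_rV_lin1 memv_proj.
by exists v; rewrite mul_rV_lin1; apply/esym/projv_id.
Qed.

Lemma dim_row_free (V : Lin) r (A : 'M[K]_(r, N.+1)) : row_free A ->
  (forall v : E, (v <= A)%MS = (v \in V)) -> \dim V = r.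
Proof.
move=> freeA AV; pose X := [tuple row i A | i < r].
have XE (i : 'I_r) : X`_i = row i A by rewrite -tnth_nth tnth_mktuple.
have -> : V = <<X>>%VS.
  apply/eqP; rewrite eqEsubv; apply/andP; split.
    apply/subvP => v; rewrite -AV => /submxP[u ->].
    rewrite mulmx_sum_row; apply: memv_suml => i _; apply/memvZ/memv_span.
    by rewrite -XE mem_nth // size_tuple.
  apply/span_subvP => v /(nthP 0)[i]; rewrite size_tuple => lti <-.
  by have -> : X`_i = row (Ordinal lti) A := XE (Ordinal lti);
    rewrite -AV row_sub.
suff /eqP-> : free X by rewrite size_tuple.
apply/freeP => c sum0 i; pose u := \row_j c j.
have : u *m A = 0 *m A.
  rewrite mul0mx mulmx_sum_row -[RHS]sum0; apply: eq_bigr => j _.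
  by rewrite mxE XE.
by move/(row_free_inj freeA)/rowP/(_ i); rewrite !mxE.
Qed.

Lemma lang_vspace g s i (V : Lin) : (0 < s)%N ->
  iter s frob V = V -> pgl_act g V = V ->
  exists A : 'M[K]_(\dim V, N.+1),
    [/\ row_free A, forall v : E, (v <= A)%MS = (v \in V) &
        map_mx (fun x => x ^+ (q ^ s)) A = A *m G g ^+ i].
Proof.
move=> s0 FV gV; have [B BV] := vspace_mx V.
have [Fr FrE] := frobenius_rmorphism iota s.
have FrU := pglmxX_map iota s g i; rewrite (map_mx_frobE FrE) in FrU.
have BU : stablemx B (G g ^+ i).
  apply/row_subP => j; rewrite row_mul BV.
  rewrite -(iter_pgl_fix i gV); apply/mem_iter_pgl.
  by exists (row j B) => //; rewrite -BV row_sub.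
have FrB : (map_mx Fr B <= B)%MS.
  apply/row_subP => j; rewrite -map_row BV -FV; apply/(mem_iter_frob iota).
  exists (row j B); first by rewrite -BV row_sub.
  by rewrite iter_frob_vecE (map_mx_frobE FrE).
(* [lang_basis] asks for one m that trivialises both the matrix and the Frobenius: a period of the
   entries of [B] times the order of GL. *)
have per : exists m,
  [/\ (0 < m)%N, (G g ^+ i) ^+ m = 1 & iter m (map_mx Fr) B = B].
  have [r r0 rB] := frobenius_periodic_mx B.
  exists (r * nGL)%N; split; first by rewrite muln_gt0 r0 cardG_gt0.
    by rewrite exprAC mulnC exprM pglmx_order !expr1n.
  have iterFr t : iter t (map_mx Fr) B = map_mx (fun x => x ^+ (q ^ (t * s))) B.
    elim: t => [|t IH] /=; first by apply/matrixP => a b; rewrite mxE expr1.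
    by rewrite IH; apply/matrixP => a b;
      rewrite !mxE FrE -exprM -expnD mulSn addnC.
  by rewrite iterFr -mulnA rB.
have [A [freeA AB FrA]] :=
  lang_basis (card_kX_gt1 s0) (pchar_nat_card iota s) FrE FrU BU FrB per.
have AV v : (v <= A)%MS = (v \in V) by rewrite AB BV.
have rE := dim_row_free freeA AV; rewrite -(map_mx_frobE FrE) in FrA.
by move: A freeA {AB} AV FrA; rewrite -rE => A freeA AV FrA; exists A.
Qed.

Variable Om : {fset Lin}.

Definition fixed_in (g : PGL k N) s i (V : Lin) : {set Om} :=
  [set x : Om | (val x <= V)%VS &&
    (iter s frob (val x) == iter i (pgl_act g) (val x))].

Hypothesis Om_points : forall x : Om, points (val x).

(** In a Lang basis A of V, which satisfies F(A) = A G^i for F the s-th power of Frobenius, a line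
    <u A> satisfies sigma^s p = gamma^i p exactly when F(u) is proportional to u. This condition
    involves neither gamma nor i, so the linear map carrying A to A' sends solutions to
    solutions. *)
Lemma card_fixed_in_le g g' s i i' (V V' : Lin) : (0 < s)%N ->
  (forall p, points p -> iter s frob p = iter i' (pgl_act g') p -> p \in Om) ->
  iter s frob V = V -> pgl_act g V = V ->
  iter s frob V' = V' -> pgl_act g' V' = V' -> \dim V = \dim V' ->
  (#|fixed_in g s i V| <= #|fixed_in g' s i' V'|)%N.
Proof.
move=> s0 OmP FV gV FV' gV' dimVV'.
have [A [freeA AV FrA]] := lang_vspace i s0 FV gV.
have [A' [freeA' A'V' FrA']] := lang_vspace i' s0 FV' gV'.
rewrite -dimVV' in A' freeA' A'V' FrA' *.
have [Fr FrE] := frobenius_rmorphism iota s.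
pose h : 'End(E) := linfun (mulmxr (pinvmx A *m A')).
have hE u : h (u *m A) = u *m A'.
  rewrite lfunE /=. by rewrite -mulmxA (mulmxA A) mulmxVp // mul1mx.
have coord (x : Om) : x \in fixed_in g s i V -> exists u : 'rV_(\dim V),
    [/\ u != 0, val x = <[u *m A]>%VS & (h @: val x)%VS = <[u *m A']>%VS].
  rewrite inE => /andP[xV _]; have [v v0 xE] := point_line (Om_points x).
  move: xV; rewrite xE -memvE -AV => /submxP[u vE]; exists u; split.
  - by apply: contraNneq v0 => u0; rewrite vE u0 mul0mx.
  - by rewrite vE.
  - by rewrite vE limg_line hE.
have neq0 r (C : 'M[K]_(r, N.+1)) (u : 'rV_r) : row_free C -> u != 0 ->
  u *m C != 0.
  move=> freeC; apply: contraNneq => /eqP.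
  by rewrite -(mul0mx _ C) (inj_eq (row_free_inj freeC)).
have fixP (x : Om) : x \in fixed_in g s i V ->
    let p := (h @: val x)%VS in
    [/\ points p, (p <= V')%VS & iter s frob p = iter i' (pgl_act g') p].
  move=> xF; have [u [u0 xE ->]] := coord x xF.
  have uA'0 := neq0 _ _ _ freeA' u0; split; first exact: line_point.
    by rewrite -memvE -A'V' submxMl.
  move: xF; rewrite inE xE => /andP[_ /eqP].
  rewrite !(iter_frob_line iota) !iter_pgl_line.
  have mapE (C : 'M_(_, N.+1)) : iter s frob_vec (u *m C) =
      map_mx Fr u *m map_mx (fun x => x ^+ (q ^ s)) C.
    by rewrite iter_frob_vecE !(map_mx_frobE FrE) map_mxM.
  have Fu0 : map_mx Fr u != 0 by rewrite map_mx_eq0.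
  rewrite !mapE FrA FrA' !mulmxA => /eq_lineP[].
    apply: contraTneq (neq0 _ _ _ freeA Fu0) =>
      /(congr1 (mulmx^~ (invmx (G g ^+ i)))).
    by rewrite -(mulmxA _ _ (invmx _)) mulmxV ?pglmxX_unit // mulmx1 mul0mx =>
      ->; rewrite eqxx.
  move=> c c0; rewrite scalemxAl => /(congr1 (mulmx^~ (invmx (G g ^+ i)))).
  rewrite -[LHS]mulmxA -[RHS]mulmxA !mulmxV ?pglmxX_unit // !mulmx1 scalemxAl.
  by move/(row_free_inj freeA) => ->; rewrite -!scalemxAl lineZ.
pose f (x : Om) : Om := insubd x (h @: val x)%VS.
have fE x : x \in fixed_in g s i V -> val (f x) = (h @: val x)%VS.
  move=> xF; have [pp _ pF] := fixP x xF.
  by rewrite val_insubd (OmP _ pp pF).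
rewrite -(card_in_imset (f := f)).
  apply/subset_leq_card/fintype.subsetP => _ /imsetP[x xF ->].
  by have [_ pV' /eqP pF] := fixP x xF; rewrite inE fE // pV' pF.
move=> x y xF yF /(congr1 val); rewrite !fE //.
have [u [u0 xE ->]] := coord x xF; have [w [w0 yE ->]] := coord y yF.
move=> /(eq_lineP _ (neq0 _ _ _ freeA' u0))[c c0].
rewrite scalemxAl => /(row_free_inj freeA') uE.
by apply: val_inj; rewrite xE yE uE -scalemxAl lineZ.
Qed.

End LangLines.

(** * Counting points in the nodes of the poset *)

Lemma card_disjoint_cover (T I : finType) (P : pred I) (U : {set T})
  (F : I -> {set T}) :
  (forall x, reflect (exists2 i, P i & x \in F i) (x \in U)) ->
  (forall x i j, P i -> P j -> x \in F i -> x \in F j -> i = j) ->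
  #|U| = (\sum_(i | P i) #|F i|)%N.
Proof.
move=> coverU disjF; rewrite -sum1_card.
under [RHS]eq_bigr do rewrite -sum1_card big_mkcond.
rewrite exchange_big /= big_mkcond; apply: eq_bigr => x _.
case: coverU => [[i Pi xF]|nU].
  rewrite (bigD1 i) //= xF big1 // => j /andP[Pj ji].
  case: ifP => // xFj; by rewrite (disjF x j i) ?eqxx in ji.
by rewrite big1 // => i Pi; case: ifP => // xF; case: nU; exists i.
Qed.

Section NodePoints.

Variables (k : finFieldType) (K : closedFieldType) (iota : {rmorphism k -> K}).
Hypothesis K_alg : forall x : K, algebraicOver iota x.
Variables (N n : nat).

Local Notation Lin := {vspace 'rV[K]_N.+1}.
Local Notation frob := (@frob k K N).
Local Notation pgl_act := (@pgl_act k K iota N).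
Local Notation points := (@points K N).
Local Notation proper_lin := (@proper_lin k K iota N).
Local Notation hull := (@hull k K iota N).
Local Notation pdeg := (@pdeg k K N).
Local Notation frob_orbit := (@frob_orbit k K N).
Local Notation nodes := (@nodes k K iota N).
Local Notation node_rep := (@node_rep K N).
Local Notation node_le := (@node_le k K N).
Local Notation nPGL := #|[set: PGL k N]|.

(* Every point occurring in a rational multiset of size at most [n], or       *)
(* satisfying [frob^s p = g^i p] with [0 < s <= n], is fixed by this power of *)
(* the Frobenius.                                                             *)
Definition period : nat := (n`! * nPGL)%N.

Definition Om : {fset Lin} :=
  fset_set [set p : Lin | points p /\ iter period frob p = p]%classic.

Lemma OmE p : p \in Om <-> points p /\ iter period frob p = p.
Proof.
have fin := @fixed_points_finite k K iota N period.
by rewrite in_fset_set ?inE //; apply: fin; rewrite muln_gt0 fact_gt0 cardG_gt0.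
Qed.

Lemma Om_points (x : Om) : points (val x).
Proof. by have /OmE[] := valP x. Qed.

Lemma pgl_iter_order g i (V : Lin) : iter (i * nPGL) (pgl_act g) V = V.
Proof.
rewrite pgl_iter mulnC expgM.
have /eqP-> : (g ^+ nPGL)%g == 1%g by rewrite -order_dvdn order_dvdG ?inE.
by rewrite expg1n pgl_act1.
Qed.

Lemma iter_frob_pgl s i g (V : Lin) :
  iter s frob (iter i (pgl_act g) V) = iter i (pgl_act g) (iter s frob V).
Proof. by elim: i => //= i IH; rewrite (pgl_iter_frob iota) IH. Qed.

(** Iterating the relation m times gives sigma^(m s) p = gamma^(i m) p. Take m = (n! / s) * |PGL|,
    so that the power of gamma acts trivially. *)
Lemma fixed_in_Om g s i p : (0 < s <= n)%N -> points p ->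
  iter s frob p = iter i (pgl_act g) p -> p \in Om.
Proof.
move=> sn pp sp; apply/OmE; split=> //.
have spm m : iter (m * s) frob p = iter (i * m) (pgl_act g) p.
  elim: m => [|m IH]; first by rewrite muln0.
  by rewrite mulSn iterD IH iter_frob_pgl sp -iterD mulnS addnC.
have /dvdnP[t ft] : (s %| n`!)%N by apply: dvdn_fact.
by rewrite /period ft mulnAC spm mulnA pgl_iter_order.
Qed.

Lemma frob_Om (x : Om) : frob (val x) \in Om.
Proof.
have /OmE[pp px] := valP x; apply/OmE; split; first exact: (frob_points iota).
by rewrite -iterSr iterS px.
Qed.

Lemma pgl_Om g (x : Om) : pgl_act g (val x) \in Om.
Proof.
have /OmE[pp px] := valP x; apply/OmE; split; first exact/pgl_pointsE.
by have := iter_frob_pgl period 1 g (val x); rewrite /= px.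
Qed.

Fact frob_perm_inj : injective (fun x : Om => [` frob_Om x]%fset).
Proof. by move=> x y /(congr1 val) /(frob_inj iota) /val_inj. Qed.

Definition frob_perm : {perm Om} := perm frob_perm_inj.

Fact pgl_perm_inj g : injective (fun x : Om => [` pgl_Om g x]%fset).
Proof. by move=> x y /(congr1 val) /pgl_act_inj /val_inj. Qed.

Definition pgl_perm g : {perm Om} := perm (@pgl_perm_inj g).

Lemma frob_permE x : val (frob_perm x) = frob (val x).
Proof. by rewrite permE. Qed.

Lemma pgl_permE g x : val (pgl_perm g x) = pgl_act g (val x).
Proof. by rewrite permE. Qed.

Lemma frob_permXE j x : val ((frob_perm ^+ j)%g x) = iter j frob (val x).
Proof. by elim: j => [|j IH]; rewrite ?perm1 // expgSr permM frob_permE IH. Qed.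

Lemma pgl_permXE g j x : val ((pgl_perm g ^+ j)%g x) =
  iter j (pgl_act g) (val x).
Proof. by elim: j => [|j IH]; rewrite ?perm1 // expgSr permM pgl_permE IH. Qed.

Lemma frob_pgl_perm g : commute frob_perm (pgl_perm g).
Proof.
apply/permP => x; rewrite !permM; apply: val_inj.
by rewrite pgl_permE !frob_permE pgl_permE; apply/esym/(iter_frob_pgl 1 1).
Qed.

(** The image of a basis spans, so dimensions cannot grow, and periodicity of V brings the dimension
    back. *)
Lemma dim_iter_frob g j V : proper_lin g V -> \dim (iter j frob V) = \dim V.
Proof.
have le_dim i W : (\dim (iter i frob W) <= \dim W)%N.
  elim: i => //= i IH; apply: leq_trans IH.
  by apply: leq_trans (dim_span _) _; rewrite size_map size_tuple.
move=> prV; apply/eqP; rewrite eqn_leq le_dim /=.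
have [r r0 rV] := proper_periodic prV.
have rjV : iter (j * r) frob V = V.
  by elim: j => // j IH; rewrite mulSn iterD IH.
have jr : (j <= j * r)%N by rewrite leq_pmulr.
by rewrite -{1}rjV -(subnK jr) iterD le_dim.
Qed.

Lemma iter_frob_lt_inj g V i j : proper_lin g V -> (i < pdeg V)%N ->
  (j < pdeg V)%N ->
  iter i frob V = iter j frob V -> i = j.
Proof.
move=> prV; wlog le_ij : i j / (i <= j)%N.
  move=> H li lj E; case: (leqP i j) => [|/ltnW] le; first exact: H.
  by apply/esym/H.
move=> li lj; rewrite -(subnKC le_ij) iterD => E.
have /esym/(pdeg_dvd _ prV) := iter_inj (@frob_inj k K iota N) E.
case: (posnP (j - i)) => [->|ji0 /(dvdn_leq ji0)]; first by rewrite addn0.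
by rewrite leqNgt (leq_ltn_trans (leq_subr i j) lj).
Qed.

(** For the orbit A of V, these are the points of [Om] in the conjugates of V^0, by
    [open_part_hull]. *)
Definition node_pts g (A : set Lin) : {set Om} :=
  [set x : Om | `[< A (hull g (val x)) >]].

Definition node_fix g A s i : {set Om} :=
  [set x in node_pts g A | iter s frob (val x) == iter i (pgl_act g) (val x)].

(** Provides the decreasing measure for induction over the poset. *)
Lemma node_lt_dim g A B : nodes g A -> nodes g B -> node_le B A -> B != A ->
  (\dim (node_rep B) < \dim (node_rep A))%N.
Proof.
move=> /node_repP[prV _ AE] /node_repP[prW oW BE] [W [V [BW AV [i WV]]]] nAB.
have [j _ WE] : frob_orbit W (node_rep B) by rewrite -BW.
have [l _ VE] : frob_orbit (node_rep A) V by rewrite -AE AV;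
  apply: frob_orbit_self.
have WVl : (node_rep B <= iter (j + i + l) frob (node_rep A))%VS.
  by rewrite -WE iterD VE iterD (iter_frob_sub iota).
rewrite -(dim_iter_frob (j + i + l) prV); have := dimvS WVl.
rewrite leq_eqVlt => /orP[/eqP dimE|//]; case/eqP: nAB; rewrite BE AE.
apply: (frob_orbit_eq prV); exists (j + i + l)%N => //; apply/esym/eqP.
by rewrite eqEdim WVl dimE leqnn.
Qed.

Lemma node_fixP g A s i x : reflect (A (hull g (val x)) /\
    iter s frob (val x) = iter i (pgl_act g) (val x)) (x \in node_fix g A s i).
Proof.
rewrite !inE; apply: (iffP andP) => [[/asboolP ? /eqP ?] //|[? ?]].
by split; [apply/asboolP | apply/eqP].
Qed.

Lemma node_hull g (x : Om) : nodes g (frob_orbit (hull g (val x))).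
Proof. by exists (hull g (val x)) => //; have [] := hullP iota g (Om_points x).
Qed.

Lemma node_of_hull g A (x : Om) : nodes g A -> A (hull g (val x)) ->
  A = frob_orbit (hull g (val x)).
Proof. by move=> /node_repP[prV _ {1 2}->] /(frob_orbit_eq prV). Qed.

(* If [frob^s x] and [g^i x] agree then [frob^s] fixes the hull of [x].       *)
Lemma node_fix_eq0 g A s i : nodes g A -> ~~ (pdeg (node_rep A) %| s)%N ->
  #|node_fix g A s i| = 0%N.
Proof.
move=> nA; have [prV _ AE] := node_repP nA; set V := node_rep A in prV AE *.
move=> nds; apply/eqP; rewrite cards_eq0; apply/eqP/finset.setP => x;
  rewrite finset.in_set0.
apply/negP => /node_fixP[Ax sx]; case/negP: nds; apply/(pdeg_dvd _ prV).
have pp := Om_points x; have := congr1 (hull g) sx.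
rewrite hull_iter_frob // hull_iter_pgl //.
move: Ax; rewrite AE => -[j _ <-]; rewrite -iterD addnC iterD.
exact/iter_inj/(@frob_inj k K iota N).
Qed.

(** A conjugate of V contains x exactly when it contains the hull of x, by [hull_sub]. *)
Lemma le_hull g A (x : Om) : nodes g A ->
  (exists2 j, (j < pdeg (node_rep A))%N &
    (val x <= iter j frob (node_rep A))%VS) <->
  node_le (frob_orbit (hull g (val x))) A.
Proof.
move=> /node_repP[prV _ AE]; set V := node_rep A in prV AE *.
have pp := Om_points x; have [prH pH _] := hullP iota g pp; split.
  case=> j _ xV; exists (hull g (val x)), V; split=> //.
  by exists j; apply: hull_sub => //; apply: proper_iter_frob.
case=> W [V' [HW AV' [i WV]]].
have [j _ HE] : frob_orbit W (hull g (val x)) by rewrite -HW;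
  apply: frob_orbit_self.
have [l _ VE] : frob_orbit V V' by rewrite -AE AV'; apply: frob_orbit_self.
have oVl : frob_orbit V (iter (j + i + l) frob V) by exists (j + i + l)%N.
have [t lt_t tE] := (frob_orbitP _ prV).1 oVl; exists t => //.
rewrite -tE; apply: subv_trans pH _.
by rewrite -HE !iterD VE (iter_frob_sub iota).
Qed.

Lemma card_fixed_iter g s i j (V : Lin) :
  #|fixed_in iota Om g s i (iter j frob V)| = #|fixed_in iota Om g s i V|.
Proof.
elim: j => //= j <-; rewrite -[RHS](card_imset _ (@perm_inj _ frob_perm));
  apply: eq_card => y.
have [x ->] : exists x, y = frob_perm x by exists ((frob_perm^-1)%g y);
  rewrite permKV.
rewrite mem_imset; last exact: perm_inj.
rewrite !inE frob_permE (frob_sub iota) -iterSr iterS; congr (_ && _).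
have /= <- := iter_frob_pgl 1 i g (val x).
by rewrite (inj_eq (@frob_inj k K iota N)).
Qed.

(** The solutions in the union of the conjugates of V are counted in two ways: by the node of their
    hull, and by the conjugate containing them. The deg V conjugates share no point, by [proper_eq],
    since they have equal exponents. *)
Lemma sum_node_fix g A s i : nodes g A -> (pdeg (node_rep A) %| s)%N ->
  (\sum_(B <- fset_set (nodes g) | `[< node_le B A >]) #|node_fix g B s i| =
   pdeg (node_rep A) * #|fixed_in iota Om g s i (node_rep A)|)%N.
Proof.
move=> nA ds; have [prV _ AE] := node_repP nA.
have fin := @nodes_finite k K iota N g.
transitivity (\sum_(j < pdeg (node_rep A)) #|fixed_in iota Om g s i
  (iter j frob (node_rep A))|)%N; last first.
  by under eq_bigr do rewrite card_fixed_iter; rewrite sum_nat_const card_ord.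
pose U : {set Om} :=
  [set x : Om | `[< node_le (frob_orbit (hull g (val x))) A >] &&
  (iter s frob (val x) == iter i (pgl_act g) (val x))].
transitivity #|U|; last first.
  apply: card_disjoint_cover => [x|x j j' _ _].
    rewrite inE; apply: (iffP andP) =>
      [[/asboolP/(le_hull x nA)[j ltj xV] sx]|[j _]].
      by exists (Ordinal ltj) => //; rewrite inE xV.
    rewrite inE => /andP[xV ->]; split=> //; apply/asboolP/(le_hull x nA).
    by exists j.
  rewrite !inE => /andP[xV _] /andP[xV' _]; apply: val_inj => /=.
  apply: (iter_frob_lt_inj prV) => //.
  apply: (proper_eq (proper_iter_frob j prV) (proper_iter_frob j' prV) _ _ xV
    xV').
    by rewrite !pexp_iter_frob.
  exact: Om_points.
rewrite big_seq_fsetE /=; apply/esym.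
apply: card_disjoint_cover => [x|x B B' _ _].
  rewrite inE; apply: (iffP andP) => [[lex sx]|[B leB /node_fixP[Bx ->]]].
    have oH : frob_orbit (hull g (val x)) \in fset_set (nodes g).
      by rewrite in_fset_set // inE; apply: node_hull.
    by exists [` oH]%fset => //; apply/node_fixP; split;
      [apply: frob_orbit_self | apply/eqP].
  split=> //; have nB : nodes g (val B) by have :=
    valP B; rewrite in_fset_set // inE.
  by rewrite -(node_of_hull nB Bx).
have nodeE (C : fset_set (nodes g)) : x \in node_fix g (val C) s i ->
    val C = frob_orbit (hull g (val x)).
  case/node_fixP=> Cx _; apply: node_of_hull Cx.
  by have := valP C; rewrite in_fset_set // inE.
by move=> /nodeE BE /nodeE B'E; apply: val_inj; rewrite BE B'E.
Qed.

End NodePoints.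

Section NodeInvariance.

Variables (k : finFieldType) (K : closedFieldType) (iota : {rmorphism k -> K}).
Hypothesis K_alg : forall x : K, algebraicOver iota x.
Variables (N n : nat).

Local Notation Lin := {vspace 'rV[K]_N.+1}.
Local Notation frob := (@frob k K N).
Local Notation pgl_act := (@pgl_act k K iota N).
Local Notation points := (@points K N).
Local Notation proper_lin := (@proper_lin k K iota N).
Local Notation pdeg := (@pdeg k K N).
Local Notation nodes := (@nodes k K iota N).
Local Notation node_rep := (@node_rep K N).
Local Notation node_le := (@node_le k K N).
Local Notation Om := (@Om k K N n).
Local Notation node_fix := (@node_fix k K iota N n).
Local Notation weight := (@weight k K iota N).
Local Notation fixed_in := (@fixed_in k K iota N Om).

(** The condition inside [same_subtype], with the isomorphism exposed for transport. *)
Definition subtype_iso g h (phi : set Lin -> set Lin) : Prop :=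
  [/\ set_bij (nodes g) (nodes h) phi,
      forall A B, nodes g A -> nodes g B ->
        (node_le A B <-> node_le (phi A) (phi B)) &
      forall A, nodes g A -> weight h (phi A) = weight g A].

Lemma dim_node g A : nodes g A -> \dim (node_rep A) = (pdim (node_rep A)).+1.
Proof.
case/node_repP => [[[V0 _] _] _ _]; rewrite /pdim prednK // lt0n.
by rewrite dimv_eq0.
Qed.

Lemma in_nodes g A : (A \in fset_set (nodes g)) = `[< nodes g A >].
Proof. by rewrite in_fset_set ?inE //; apply: nodes_finite. Qed.

Lemma big_nodes_iso (R : Type) (idx : R) (op : Monoid.com_law idx) g h phi
    (P : pred (set Lin)) (F : set Lin -> R) : subtype_iso g h phi ->
  \big[op/idx]_(B <- fset_set (nodes h) | P B) F B =
  \big[op/idx]_(B <- fset_set (nodes g) | P (phi B)) F (phi B).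
Proof.
case=> [[phi_fun phi_inj phi_surj] _ _].
have -> : fset_set (nodes h) = [fset phi B | B in fset_set (nodes g)]%fset.
  apply/fsetP => B; rewrite in_nodes; apply/asboolP/imfsetP =>
    [/phi_surj[A nA <-]|[A /=]].
    by exists A => //=; rewrite in_nodes; apply/asboolP.
  by rewrite in_nodes => /asboolP nA ->; apply: phi_fun.
rewrite big_mkcond big_imfset /=; last first.
  move=> A B; rewrite !in_nodes => /asboolP nA /asboolP nB.
  by apply: phi_inj; rewrite inE.
by rewrite [RHS]big_mkcond.
Qed.

Lemma card_fixed_in g h s i i' (V W : Lin) : (0 < s <= n)%N ->
  proper_lin g V -> proper_lin h W -> \dim V = \dim W -> pdeg V = pdeg W ->
  (pdeg V %| s)%N -> #|fixed_in g s i V| = #|fixed_in h s i' W|.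
Proof.
move=> sn prV prW dimE degE ds; have /andP[s0 _] := sn.
have fV : iter s frob V = V by apply/(pdeg_dvd _ prV).
have fW : iter s frob W = W by apply/(pdeg_dvd _ prW); rewrite -degE.
have [[[_ gV] _] [[_ hW] _]] := (prV, prW).
have OmP g' i0 p : points p -> iter s frob p = iter i0 (pgl_act g') p ->
  p \in Om.
  exact: fixed_in_Om.
apply/eqP; rewrite eqn_leq; apply/andP; split; apply: card_fixed_in_le => //;
  by [exact: Om_points | exact: OmP].
Qed.

Lemma node_le_refl g A : nodes g A -> node_le A A.
Proof.
move=> /node_repP[_ _ AE]; exists (node_rep A), (node_rep A); split=> //.
by exists 0; apply: subvv.
Qed.

(* The number of points of all nodes below [A] fixed by [frob^s g^-i] only    *)
(* depends on [dim A] and [deg A], whence the claim by induction on the       *)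
(* poset.                                                                     *)
Lemma card_node_fix g h phi s : subtype_iso g h phi -> (0 < s <= n)%N ->
  forall A i i', nodes g A -> #|node_fix g A s i| = #|node_fix h (phi A) s i'|.
Proof.
move=> iso sn A; have [[phi_fun phi_inj phi_surj] phi_le phi_w] := iso.
move: {2}(\dim (node_rep A)).+1 (ltnSn (\dim (node_rep A))) => d.
elim: d A => // d IH A dA i i' nA.
have nA' := phi_fun A nA; have := phi_w A nA => -[dimE expE degE].
have [prA _ _] := node_repP nA; have [prA' _ _] := node_repP nA'.
have [ds|nds] := boolP (pdeg (node_rep A) %| s)%N; last first.
  by rewrite !node_fix_eq0 // degE.
have ds' : (pdeg (node_rep (phi A)) %| s)%N by rewrite degE.
have fE : #|fixed_in g s i (node_rep A)| =
  #|fixed_in h s i' (node_rep (phi A))|.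
  apply: card_fixed_in => //.
  by rewrite (dim_node nA) (dim_node nA') dimE.
(* The totals over all nodes below A and below [phi A] agree. Strictly smaller nodes match by
   induction, so the terms of A and [phi A] are left equal. *)
have := sum_node_fix n i nA ds; rewrite fE -degE -(sum_node_fix n i' nA' ds').
rewrite (big_nodes_iso _ _ _ iso) /=.
have Ain : A \in fset_set (nodes g) by rewrite in_nodes; apply/asboolP.
rewrite !(big_mkcond (fun B => `[< _ >])) !(bigD1_seq A Ain (fset_uniq _)) /=.
case: asboolP => [_|[]]; last exact: node_le_refl nA.
case: asboolP => [_|[]]; last exact: node_le_refl nA'.
set S1 := (X in (_ + X)%N = _); set S2 := (X in _ = (_ + X)%N).
suff -> : S1 = S2 by move/addIn.
rewrite /S1 /S2 big_seq_cond [RHS]big_seq_cond; apply: eq_bigr => B.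
rewrite in_nodes => /andP[/asboolP nB nBA].
have -> : `[< node_le (phi B) (phi A) >] = `[< node_le B A >].
  by apply: asbool_equiv_eq; apply: iff_sym; apply: phi_le.
case: asboolP => // leBA; apply: IH => //.
exact: leq_trans (node_lt_dim nA nB leBA nBA) _.
Qed.

End NodeInvariance.

(** * Node products *)

Section NodeGhosts.

Variables (k : finFieldType) (K : closedFieldType) (iota : {rmorphism k -> K}).
Hypothesis K_alg : forall x : K, algebraicOver iota x.
Variables (N n : nat).

Local Notation frob := (@frob k K N).
Local Notation pexp := (@pexp k K iota N).
Local Notation proper_lin := (@proper_lin k K iota N).
Local Notation open_part := (@open_part k K iota N).
Local Notation hull := (@hull k K iota N).
Local Notation pdeg := (@pdeg k K N).
Local Notation nodes := (@nodes k K iota N).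
Local Notation node_rep := (@node_rep K N).
Local Notation Om := (@Om k K N n).
Local Notation node_fix := (@node_fix k K iota N n).
Local Notation node_pts := (@node_pts k K iota N n).
Local Notation frob_perm := (@frob_perm k K iota N n).
Local Notation pgl_perm := (@pgl_perm k K iota N n).

Local Notation subtype_iso := (@subtype_iso k K iota N).

Lemma frob_orbit_frob g A V : nodes g A -> proper_lin g V -> A (frob V) <-> A V.
Proof.
move=> /node_repP[prA _ ->] prV; split=> oV.
  have <- := frob_orbit_eq prA oV; have [r r0 rV] := proper_periodic prV.
  by exists r.-1 => //; rewrite -iterSr prednK.
by case: oV => j _ <-; exists j.+1.
Qed.

Lemma frob_perm_node g A x : nodes g A -> (frob_perm x \in node_pts g A) =
  (x \in node_pts g A).
Proof.
move=> nA; have pp := Om_points iota x; rewrite !inE frob_permE hull_frob //.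
by apply: asbool_equiv_eq; apply: frob_orbit_frob nA _; have [] :=
  hullP iota g pp.
Qed.

Lemma pgl_perm_node g A x : (pgl_perm g x \in node_pts g A) =
  (x \in node_pts g A).
Proof. by rewrite !inE pgl_permE hull_pgl //; apply: Om_points. Qed.

Lemma card_porbit_pgl_perm g x : #|porbit (pgl_perm g) x| = pexp g (val x).
Proof.
apply: eq_dvdn => m; rewrite card_porbit_dvdn -pexp_dvd -scalar_onP.
have px := Om_points iota x; rewrite -val_eqE /= pgl_permXE;
  split=> [/eqP xE p pp pV|H].
  suff -> : p = val x by [].
  by apply/eqP; rewrite eqEdim pV [\dim p]pp [\dim (val x)]px.
by apply/eqP/H.
Qed.

Lemma card_porbit_node g A x : nodes g A -> x \in node_pts g A ->
  #|porbit (pgl_perm g) x| = pexp g (node_rep A).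
Proof.
move=> /node_repP[_ _ AE]; rewrite inE card_porbit_pgl_perm => /asboolP.
have [_ _ <-] := hullP iota g (Om_points iota x); rewrite {1}AE => -[j _ <-].
by rewrite pexp_iter_frob.
Qed.

(* The number of points of the node [A] whose orbit under frob and [g] has    *)
(* size dividing [t].                                                         *)
Definition node_ghost g A t : nat :=
  (if (pexp g (node_rep A) %| t)%N
   then pexp g (node_rep A) * #|node_fix g A (t %/ pexp g (node_rep A)) 0|
   else 0)%N.

Lemma subtype_iso_id g : subtype_iso g g id.
Proof. by split=> //; split=> // A; exists A. Qed.

(** Put e = exp V. A point of the node has gamma-period exactly e, so if sigma^(t/e) x lies in its
    gamma-orbit then sigma^(t/e) x = gamma^i x for exactly one i < e. By [card_node_fix] with the
    identity isomorphism, all e choices of i have as many solutions as i = 0. *)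
Lemma ghost_node g A t : nodes g A -> (0 < t <= n)%N ->
  (\sum_(a in atom frob_perm (pgl_perm g) @: node_pts g A |
       #|[set x in node_pts g A | atom frob_perm (pgl_perm g) x == a]| %| t)
     #|[set x in node_pts g A | atom frob_perm (pgl_perm g) x == a]| =
       node_ghost g A t)%N.
Proof.
move=> nA /andP[t0 tn]; set e := pexp g (node_rep A).
have e0 : (0 < e)%N by apply: pexp_gt0.
rewrite (ghost_atom (e := e) (@frob_pgl_perm k K iota N n g)); first last.
- by move=> x; apply: card_porbit_node.
- exact: e0.
- exact: pgl_perm_node.
- by move=> x; apply: frob_perm_node.
rewrite /node_ghost -/e; case: ifP => // et.
have ten : (0 < t %/ e <= n)%N.
  by rewrite divn_gt0 // (dvdn_leq t0 et) (leq_trans (leq_div _ _) tn).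
transitivity (\sum_(i < e) #|node_fix g A (t %/ e) i|)%N; last first.
  under eq_bigr do rewrite (card_node_fix K_alg (subtype_iso_id g) ten _ 0 nA)
    /=.
  by rewrite sum_nat_const card_ord.
apply: card_disjoint_cover => [x|x i j _ _].
  rewrite inE; apply: (iffP andP) => [[xD]|[i _ /node_fixP[Ax sx]]].
    rewrite porbit_traject (card_porbit_node nA xD) => /trajectP[i ltie xE].
    exists (Ordinal ltie) => //; apply/node_fixP; split; first by move: xD;
      rewrite inE => /asboolP.
    by rewrite -(frob_permXE iota) xE -permX pgl_permXE.
  split; first by rewrite inE; apply/asboolP.
  apply/porbitP; exists i; apply: val_inj.
  by rewrite /= frob_permXE pgl_permXE.
move=> /node_fixP[Ax sx] /node_fixP[_ sx']; apply: val_inj => /=.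
have xD : x \in node_pts g A by rewrite inE; apply/asboolP.
have := uniq_traject_porbit (pgl_perm g) x; rewrite (card_porbit_node nA xD) =>
  U.
have : nth x (traject (pgl_perm g) x e) i = nth x (traject (pgl_perm g) x e) j.
  rewrite !nth_traject //; apply: val_inj; rewrite /= -!permX !pgl_permXE.
  by rewrite -sx -sx'.
by move/eqP; rewrite nth_uniq ?size_traject // => /eqP.
Qed.

Definition open_pts g V : {set Om} :=
  [set x : Om | `[< open_part g V (val x) >]].

Lemma open_ptsE g V x : proper_lin g V ->
  (x \in open_pts g V) = (hull g (val x) == V).
Proof.
move=> prV; rewrite inE; apply/asboolP/eqP => [/(open_part_hull _ prV)[]//|xV].
by apply/(open_part_hull _ prV); split=> //; apply: Om_points.
Qed.

Lemma frob_open_pts g V x : proper_lin g V ->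
  ((frob_perm ^+ pdeg V)%g x \in open_pts g V) = (x \in open_pts g V).
Proof.
move=> prV; rewrite !open_ptsE // frob_permXE hull_iter_frob;
  last exact: Om_points.
have {2}<- : iter (pdeg V) frob V = V by apply/(pdeg_dvd _ prV).
by rewrite (inj_eq (iter_inj (@frob_inj k K iota N))).
Qed.

(** The node is the disjoint union of the translates sigma^j(V^0) for j < deg V, and sigma^j
    preserves the fixed-point condition. *)
Lemma card_node_fix_open g A s : nodes g A ->
  #|node_fix g A (pdeg (node_rep A) * s) 0| =
  (pdeg (node_rep A) *
   #|[set x in open_pts g (node_rep A) |
     (frob_perm ^+ (pdeg (node_rep A) * s))%g x == x]|)%N.
Proof.
move=> nA; have [prV _ AE] := node_repP nA; set V := node_rep A in prV AE *.
set t := (pdeg V * s)%N; set B := [set x in _ | _].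
transitivity (\sum_(j < pdeg V) #|(frob_perm ^+ j)%g @: B|)%N; last first.
  rewrite (eq_bigr (fun=> #|B|)) => [|j _];
    first by rewrite sum_nat_const card_ord.
  by apply: card_imset; apply: perm_inj.
have hullX x j : hull g (val ((frob_perm ^+ j)%g x)) =
  iter j frob (hull g (val x)).
  by rewrite frob_permXE hull_iter_frob //; apply: Om_points.
apply: card_disjoint_cover => [x|x i j _ _].
  apply: (iffP idP) => [/node_fixP[Ax tx]|[j _ /imsetP[y + ->]]].
    move: Ax; rewrite AE => /(frob_orbitP _ prV)[j ltj xE].
    exists (Ordinal ltj) => //=; apply/imsetP; exists ((frob_perm ^+ j)^-1 x)%g;
      last by rewrite permKV.
    rewrite inE open_ptsE //; apply/andP; split.
      apply/eqP/(iter_inj (i := j) (@frob_inj k K iota N)).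
      by rewrite -hullX permKV.
    apply/eqP/(@perm_inj _ (frob_perm ^+ j)%g);
      rewrite permKV -permM -expgD addnC expgD permM permKV.
    by apply: val_inj; rewrite frob_permXE.
  rewrite inE open_ptsE // => /andP[/eqP yV /eqP ty]; apply/node_fixP; split.
    by rewrite hullX yV AE; exists j.
  rewrite -(frob_permXE iota) /=; congr val.
  by rewrite -permM -expgD addnC expgD permM ty.
move=> /imsetP[y + xE] /imsetP[z + xE'].
rewrite inE open_ptsE // => /andP[yV _]; rewrite inE open_ptsE // =>
  /andP[zV _].
apply/val_inj/(iter_frob_lt_inj prV) => //=.
have := hullX y i; have := hullX z j.
by rewrite (eqP yV) (eqP zV) -xE -xE' => <- <-.
Qed.

(** The counterpart of [ghost_node] for the orbits of sigma^r on V^0, r = deg V, with sizes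
    multiplied by d. Its value is again [node_ghost], now by way of [card_node_fix_open]. *)
Lemma ghost_open g A t : nodes g A -> (0 < t <= n)%N ->
  let V := node_rep A in let d := (pexp g V * pdeg V)%N in
  let w a := #|[set x in open_pts g V | atom (frob_perm ^+ pdeg V)%g 1%g x ==
    a]| in
  (\sum_(a in atom (frob_perm ^+ pdeg V)%g 1%g @: open_pts g V | d * w a %| t)
    d * w a =
   node_ghost g A t)%N.
Proof.
move=> nA /andP[t0 tn] V d w; have [prV _ AE] := node_repP nA.
have e0 : (0 < pexp g V)%N by apply: pexp_gt0.
have r0 : (0 < pdeg V)%N by apply: pdeg_gt0 prV.
have d0 : (0 < d)%N by rewrite muln_gt0 e0.
(* If d does not divide t, the left sum is empty, and on the right either exp V does not divide t or
   [node_fix_eq0] applies. *)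
have [dt|ndt] := boolP (d %| t)%N; last first.
  rewrite big_pred0 => [|a]; last first.
    by apply/negP => /andP[_ h]; case/negP: ndt; apply: dvdn_trans h;
      apply: dvdn_mulr.
  rewrite /node_ghost -/V; case: ifP => // /dvdnP[u tE].
  rewrite tE mulnK // node_fix_eq0 ?muln0 // -/V.
  by apply: contra ndt => ru; rewrite tE mulnC dvdn_mul.
have /dvdnP[m tE] := dt.
transitivity (d *
  \sum_(a in atom (frob_perm ^+ pdeg V)%g 1%g @: open_pts g V | w a %| m) w
    a)%N.
  rewrite big_distrr /=; apply: eq_bigl => a; congr (_ && _).
  by rewrite tE mulnC dvdn_pmul2r.
rewrite (ghost_atom (e := 1)) ?dvd1n ?divn1 //; first last.
- move=> x _; rewrite (_ : porbit _ _ = [set x]) ?cards1 //.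
  apply/finset.setP => y; rewrite finset.in_set1; apply/porbitP/eqP =>
    [[i ->]|->].
    by rewrite expg1n perm1.
  by exists 0%N; rewrite perm1.
- by move=> x; rewrite perm1.
- by move=> x; apply: frob_open_pts.
- exact: commute1.
have -> : node_ghost g A t = (pexp g V * #|node_fix g A (pdeg V * m) 0|)%N.
  by rewrite /node_ghost -/V tE /d mulnCA dvdn_mulr // mulKn // (mulnC m).
rewrite card_node_fix_open // -/V mulnA; congr (_ * _)%N.
apply: eq_card => x; rewrite !inE; congr (_ && _); rewrite -expgM.
apply/porbitP/eqP => [[i ->]|xE]; first by rewrite expg1n perm1.
by exists 0%N; rewrite perm1.
Qed.

End NodeGhosts.

Section NodeProducts.

Variables (k : finFieldType) (K : closedFieldType) (iota : {rmorphism k -> K}).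
Hypothesis K_alg : forall x : K, algebraicOver iota x.
Variables (N n : nat).

Local Notation Lin := {vspace 'rV[K]_N.+1}.
Local Notation frob := (@frob k K N).
Local Notation points := (@points K N).
Local Notation pexp := (@pexp k K iota N).
Local Notation open_part := (@open_part k K iota N).
Local Notation hull := (@hull k K iota N).
Local Notation pdeg := (@pdeg k K N).
Local Notation frob_orbit := (@frob_orbit k K N).
Local Notation nodes := (@nodes k K iota N).
Local Notation node_rep := (@node_rep K N).
Local Notation Om := (@Om k K N n).
Local Notation node_pts := (@node_pts k K iota N n).
Local Notation frob_perm := (@frob_perm k K iota N n).
Local Notation pgl_perm := (@pgl_perm k K iota N n).

Local Notation subtype_iso := (@subtype_iso k K iota N).

Local Notation node_ghost := (@node_ghost k K iota N n).
Local Notation open_pts := (@open_pts k K iota N n).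

Lemma iter_iter (T : Type) (f : T -> T) r j x :
  iter j (iter r f) x = iter (r * j) f x.
Proof. by elim: j => [|j IH] /=; rewrite ?muln0 // IH mulnS iterD. Qed.

(** Taking the identity as second permutation makes atoms correspond to the orbits of sigma^r on
    V^0. *)
Definition open_atoms g A :=
  (atom (frob_perm ^+ pdeg (node_rep A))%g 1%g @: open_pts g (node_rep A)).

Definition open_block g A a : nat :=
  #|[set x in open_pts g (node_rep A) | atom (frob_perm ^+ pdeg (node_rep A))%g
    1%g x == a]|.

Lemma periodic_open_Om g V r m p : (r * m <= n)%N -> (0 < r)%N ->
  open_part g V p ->
  (exists2 j, (0 < j <= m)%N & iter j (iter r frob) p = p) -> p \in Om.
Proof.
move=> rmn r0 [pp _ _] [j /andP[j0 jm]]; rewrite iter_iter => jp.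
apply: (fixed_in_Om (iota := iota) (g := g) (i := 0) (s := r * j)) => //.
by rewrite muln_gt0 r0 j0 (leq_trans _ rmn) // leq_pmul2l.
Qed.

(** The substitution moves the coefficient of index m to degree exp V * deg V * m. Only degrees up
    to n matter, and within this range the points involved lie in [Om]. *)
Lemma open_gf_coef g A m : nodes g A ->
  (pexp g (node_rep A) * pdeg (node_rep A) * m <= n)%N ->
  open_gf iota g (node_rep A) m =
  (\big[fps_mul/fps_one]_(a in open_atoms g A)
     fps_subst (open_block g A a) (fps_ind (leq^~ 1%N))) m.
Proof.
move=> nA dm; have [prV _ _] := node_repP nA; set V := node_rep A in prV dm *.
have rm : (pdeg V * m <= n)%N.
  by apply: leq_trans dm; rewrite -mulnA leq_pmull // pexp_gt0.
have inj1 : injective (id : Lin -> Lin) by [].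
have sE (x : Om) : val ((frob_perm ^+ pdeg V)%g x) = iter (pdeg V) frob (val x)
  by apply: frob_permXE.
have tE (x : Om) : val ((1 : {perm Om})%g x) = id (val x) by rewrite perm1.
have [_] := card_stable_nsets (iter_inj (@frob_inj k K iota N)) inj1 sE tE
  (fun p => periodic_open_Om (p := p) (g := g) (V := V) rm (pdeg_gt0 prV)).
have -> : [set S | stable_nsets (open_part g V) (iter (pdeg V) frob) m S /\
    fset_map id S = S]%classic =
      stable_nsets (open_part g V) (iter (pdeg V) frob) m.
  by apply/seteqP; split=> [S [] //|S H]; split=> //; apply: fset_map_id.
rewrite /open_gf => ->; apply: card_invariant => //.
- exact: commute1.
- by move=> x; apply: frob_open_pts.
- by move=> x; rewrite perm1.
Qed.

Lemma open_mgf_coef g A m : nodes g A ->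
  (pexp g (node_rep A) * pdeg (node_rep A) * m <= n)%N ->
  open_mgf iota g (node_rep A) m =
  (\big[fps_mul/fps_one]_(a in open_atoms g A)
     fps_subst (open_block g A a) (fps_ind predT)) m.
Proof.
move=> nA dm; have [prV _ _] := node_repP nA; set V := node_rep A in prV dm *.
have rm : (pdeg V * m <= n)%N.
  by apply: leq_trans dm; rewrite -mulnA leq_pmull // pexp_gt0.
have inj1 : injective (id : Lin -> Lin) by [].
have sE (x : Om) : val ((frob_perm ^+ pdeg V)%g x) = iter (pdeg V) frob (val x)
  by apply: frob_permXE.
have tE (x : Om) : val ((1 : {perm Om})%g x) = id (val x) by rewrite perm1.
have [_] := card_stable_nmsets (iter_inj (@frob_inj k K iota N)) inj1 sE tE
  (fun p => periodic_open_Om (p := p) (g := g) (V := V) rm (pdeg_gt0 prV)).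
have -> : [set S | stable_nmsets (open_part g V) (iter (pdeg V) frob) m S /\
    mset_map id S = S]%classic =
      stable_nmsets (open_part g V) (iter (pdeg V) frob) m.
  by apply/seteqP; split=> [S [] //|S H]; split=> //; apply: mset_map_id.
rewrite /open_mgf => ->; apply: card_invariant => //.
- exact: commute1.
- by move=> x; apply: frob_open_pts.
- by move=> x; rewrite perm1.
Qed.

Section NodeProd.

Variables (P : pred nat) (F : PGL k N -> Lin -> fps).
Hypothesis P0 : P 0%N.
Hypothesis F_coef : forall g A m, nodes g A ->
  (pexp g (node_rep A) * pdeg (node_rep A) * m <= n)%N ->
  F g (node_rep A) m =
  (\big[fps_mul/fps_one]_(a in open_atoms g A) fps_subst (open_block g A a)
    (fps_ind P)) m.

Let d g A := (pexp g (node_rep A) * pdeg (node_rep A))%N.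

Lemma d_gt0 g A : nodes g A -> (0 < d g A)%N.
Proof. by case/node_repP => prV _ _; rewrite muln_gt0 pexp_gt0 (pdeg_gt0 prV).
Qed.

Lemma open_block_gt0 g A :
  {in open_atoms g A, forall a, 0 < open_block g A a}%N.
Proof. by move=> _ /imsetP[x xV ->]; apply/card_gt0P; exists x;
  rewrite inE xV eqxx. Qed.

Lemma subst_coef g A m : nodes g A -> (m <= n)%N ->
  fps_subst (d g A) (F g (node_rep A)) m =
  (\big[fps_mul/fps_one]_(a in open_atoms g A)
     fps_subst (d g A * open_block g A a) (fps_ind P)) m.
Proof.
move=> nA mn; have d0 := d_gt0 nA.
under [in RHS]eq_bigr do rewrite -fps_subst_subst //.
rewrite -fps_subst_prod // /fps_subst; case: ifP => // /dvdnP[j mE].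
rewrite mE mulnK // F_coef // -/(d g A) mulnC -mE //.
Qed.

(** The isomorphism preserves exponents and, by [card_node_fix], the counts in [node_ghost]; hence
    corresponding factors have equal ghosts. *)
Lemma subst_coef_iso g h phi A m : subtype_iso g h phi -> nodes g A ->
  (m <= n)%N ->
  fps_subst (d g A) (F g (node_rep A)) m =
  fps_subst (d h (phi A)) (F h (node_rep (phi A))) m.
Proof.
move=> iso nA mn; have [[phi_fun _ _] _ phi_w] := iso.
have nA' := phi_fun A nA; have := phi_w A nA => -[_ expE degE].
rewrite !subst_coef //; apply: eq_fps_prod_ghost => //.
- by move=> a aV; rewrite muln_gt0 d_gt0 // open_block_gt0.
- by move=> a aV; rewrite muln_gt0 d_gt0 // open_block_gt0.
move=> t /andP[t0 tm]; have tn : (0 < t <= n)%N by rewrite t0 (leq_trans tm mn).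
rewrite [LHS](ghost_open nA tn) [RHS](ghost_open nA' tn) /node_ghost expE.
case: ifP => // et; congr (_ * _)%N; apply: card_node_fix => //.
by rewrite divn_gt0 ?pexp_gt0 // (dvdn_leq t0 et)
  (leq_trans (leq_div _ _) (leq_trans tm mn)).
Qed.

Lemma node_prod_iso g h : same_subtype iota g h ->
  node_prod iota F g n = node_prod iota F h n.
Proof.
case=> phi iso; rewrite /node_prod [in RHS](big_nodes_iso _ _ _ iso) /=.
rewrite big_seq [in RHS]big_seq.
apply: (@fps_prod_congr n) => // A m; rewrite in_nodes => /asboolP nA mn.
exact: subst_coef_iso.
Qed.

(** The hull of a point is unchanged by gamma and moves along its orbit under sigma, so each atom
    stays inside one node and the product over atoms splits over the nodes. In each node the factor
    is identified through its ghosts, by [ghost_node] and [ghost_open]. *)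
Lemma card_inv_node_prod g :
  #|inv_functions points n frob_perm (pgl_perm g) P|%:R = node_prod iota F g n.
Proof.
have [sg nodeE] :=
  (@frob_pgl_perm k K iota N n g, fun x : Om => node_hull iota g x).
rewrite (@card_invariant _ frob_perm (pgl_perm g)
  [set x : Om | `[< points (val x) >]] sg) //; last first.
- by move=> x; rewrite !inE; apply: asbool_equiv_eq; split=> _;
    apply: Om_points.
- by move=> x; rewrite !inE; apply: asbool_equiv_eq; split=> _;
    apply: Om_points.
have -> : [set x : Om | `[< points (val x) >]] = [set: Om].
  by apply/finset.setP => x; rewrite !inE; apply/asboolP; apply: Om_points.
pose at_ := atom frob_perm (pgl_perm g).
have at_node (A : set Lin) x y : nodes g A -> at_ x = at_ y ->
  x \in node_pts g A -> y \in node_pts g A.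
  move=> nA /esym/eqP/(atomP sg)[i [j ->]] xA.
  rewrite !mem_permX //; first by move=> z; apply: frob_perm_node.
  by move=> z; apply: pgl_perm_node.
have -> : at_ @: [set: Om] =
  \bigcup_(A : fset_set (nodes g)) (at_ @: node_pts g (val A)).
  apply/finset.setP => a; apply/imsetP/bigcupP =>
    [[x _ ->]|[A _ /imsetP[x _ ->]]]; last by exists x.
  have oH : frob_orbit (hull g (val x)) \in fset_set (nodes g).
    by rewrite in_nodes; apply/asboolP/nodeE.
  exists [` oH]%fset => //; apply: imset_f; rewrite inE /=.
  by apply/asboolP; apply: frob_orbit_self.
rewrite partition_disjoint_bigcup /=; last first.
  move=> A B nAB; rewrite -setI_eq0; apply/set0Pn => -[a /setIP[]].
  case/imsetP=> x xA -> /imsetP[y yB xy].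
  have nA : nodes g (val A) by have := valP A; rewrite in_nodes => /asboolP.
  have nB : nodes g (val B) by have := valP B; rewrite in_nodes => /asboolP.
  have := at_node _ _ _ nA xy xA; rewrite inE => /asboolP yA.
  move: yB; rewrite inE => /asboolP yB; case/eqP: nAB; apply: val_inj.
  by rewrite (node_of_hull nA yA) (node_of_hull nB yB).
rewrite /node_prod big_seq_fsetE /=.
apply: (@fps_prod_congr n) => // A m _ mn.
have nA : nodes g (val A) by have := valP A; rewrite in_nodes => /asboolP.
rewrite subst_coef //.
rewrite (eq_bigr
  (fun a => fps_subst #|[set x in node_pts g (val A) | at_ x == a]|
    (fps_ind P))); last first.
  move=> _ /imsetP[x xA ->]; congr (fps_subst _ _); apply: eq_card => y.
  rewrite !inE /=; case: eqP => [yx|]; last by rewrite andbF.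
  by have := at_node _ _ _ nA (esym yx) xA; rewrite inE => ->.
apply: eq_fps_prod_ghost => //.
- by move=> _ /imsetP[x xA ->]; apply/card_gt0P; exists x; rewrite inE xA eqxx.
- by move=> a aV; rewrite muln_gt0 d_gt0 // open_block_gt0.
move=> t /andP[t0 tm]; have tn : (0 < t <= n)%N by rewrite t0 (leq_trans tm mn).
by rewrite [LHS](ghost_node K_alg nA tn) [RHS](ghost_open nA tn).
Qed.

End NodeProd.

Lemma periodic_Om p : points p ->
  (exists2 j, (0 < j <= n)%N & iter j frob p = p) -> p \in Om.
Proof. by move=> pp [j jn jp];
  apply: (fixed_in_Om (iota := iota) (g := 1%g) (i := 0) (s := j)). Qed.

End NodeProducts.

(** * Summing over subtypes *)

Section SubtypeEquiv.

Variables (k : finFieldType) (K : closedFieldType) (iota : {rmorphism k -> K}).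
Variable N : nat.
Local Notation same_subtype := (@same_subtype k K iota N).
Local Notation nodes := (@nodes k K iota N).

Lemma same_subtype_refl g : same_subtype g g.
Proof. by exists id; apply: subtype_iso_id. Qed.

Lemma same_subtype_sym g h : same_subtype g h -> same_subtype h g.
Proof.
case=> phi [[phi_fun phi_inj phi_surj] phi_le phi_w].
pose psi B := xget set0 [set A | nodes g A /\ phi A = B]%classic.
have psiP B : nodes h B -> nodes g (psi B) /\ phi (psi B) = B.
  move=> /phi_surj[A nA AB]; rewrite /psi; case: xgetP => [A' _ []//|/(_ A) []].
  by [].
exists psi; split.
- split=> [B /psiP[] //|B B'|A nA].
    rewrite !inE => /psiP[_ {2}<-] /psiP[_ {2}<-] -> //.
  exists (phi A); first exact: phi_fun.
  have [npsi phipsi] := psiP _ (phi_fun A nA).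
  by apply: phi_inj => //; rewrite inE.
- move=> B B' /psiP[nB BE] /psiP[nB' BE'].
  by rewrite -{1}BE -{1}BE'; apply: iff_sym; apply: phi_le.
- by move=> B /psiP[nB BE]; rewrite -{2}BE phi_w.
Qed.

Lemma same_subtype_trans g h u : same_subtype g h -> same_subtype h u ->
  same_subtype g u.
Proof.
case=> phi [[phi_fun phi_inj phi_surj] phi_le phi_w].
case=> psi [[psi_fun psi_inj psi_surj] psi_le psi_w].
exists (psi \o phi); split.
- split=> [A /phi_fun/psi_fun //|A B|C /psi_surj[B /phi_surj[A nA <-] <-]];
    last by exists A.
  rewrite !inE => nA nB /= E; apply: phi_inj; rewrite ?inE //.
  by apply: psi_inj; rewrite ?inE //; apply: phi_fun.
- move=> A B nA nB; apply: iff_trans (phi_le A B nA nB) _.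
  by apply: psi_le; apply: phi_fun.
- by move=> A nA /=; rewrite psi_w ?phi_w //; apply: phi_fun.
Qed.

End SubtypeEquiv.

Section Main.

Variables (k : finFieldType) (K : closedFieldType) (iota : {rmorphism k -> K}).
Hypothesis K_alg : forall x : K, algebraicOver iota x.
Variables (N n : nat) (C : {set PGL k N}).
Hypothesis C_repr : is_transversal C (classes [set: PGL k N]) [set: PGL k N].
Variable rep : {set PGL k N} -> PGL k N.
Hypothesis rep_in : forall alpha, alpha \in subtypes iota C ->
  rep alpha \in alpha.

(** The subtypes partition [C] and G is constant on each, so any choice of [rep] gives the same
    value. *)
Lemma sum_subtypes (G : PGL k N -> rat) :
  (forall g h, same_subtype iota g h -> G g = G h) ->
  \sum_(alpha in subtypes iota C) mass alpha * G (rep alpha) =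
  \sum_(g in C) (#|'C[g]%g|%:R)^-1 * G g.
Proof.
move=> GP; have partC : finset.partition (subtypes iota C) C.
  apply: equivalence_partitionP => x y z _ _ _; split.
    by apply/asboolP; apply: same_subtype_refl.
  move/asboolP => xy; apply/asboolP/asboolP => H.
    exact: same_subtype_trans (same_subtype_sym xy) H.
  exact: same_subtype_trans xy H.
rewrite (set_partition_big _ partC) /=; apply: eq_bigr => alpha al.
rewrite /mass mulr_suml; apply: eq_bigr => g ga; congr (_ * _); apply: GP.
have := rep_in al; case/imsetP: al ga => x xC ->.
rewrite !inE => /andP[_ /asboolP xg] /andP[_ /asboolP xr].
exact: same_subtype_trans (same_subtype_sym xr) xg.
Qed.

(** Burnside's lemma, grouped by conjugacy classes and then by subtypes, stated for an abstract
    action so as to serve sets and multisets alike. *)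
Lemma orbits_coef (T : choiceType) (act : PGL k N -> T -> T) (X : set T)
    (F : PGL k N -> {vspace 'rV[K]_N.+1} -> fps) :
  finite_set X -> (forall x, act 1%g x = x) ->
  (forall a b x, act (a * b)%g x = act b (act a x)) ->
  (forall a x, X x -> X (act a x)) ->
  (forall g, (ncard [set x | X x /\ act g x = x]%classic)%:R =
    node_prod iota F g n) ->
  (forall g h, same_subtype iota g h ->
    node_prod iota F g n = node_prod iota F h n) ->
  (ncard (pgl_orbits act X))%:R =
  \sum_(alpha in subtypes iota C) mass alpha * node_prod iota F (rep alpha) n.
Proof.
move=> finX act1 actM actX fixE Fiso.
rewrite (sum_subtypes (G := fun g => node_prod iota F g n)) //.
have nP0 : #|PGL k N|%:R != 0 :> rat
  by rewrite pnatr_eq0 -cardsT -lt0n cardG_gt0.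
have := burnside finX act1 actM actX =>
  /(congr1 (fun m : nat => m%:R / #|PGL k N|%:R : rat)).
rewrite natrM mulfK // => ->.
rewrite (sum_classes C_repr) //; last by move=> a b; apply: ncard_fix_conj.
by apply: eq_bigr => c _; rewrite fixE.
Qed.

Local Notation Lin := {vspace 'rV[K]_N.+1}.
Local Notation frob := (@frob k K N).
Local Notation pgl_act := (@pgl_act k K iota N).

Lemma num_orbits_coef :
  (num_orbits iota N n)%:R =
  \sum_(alpha in subtypes iota C) mass alpha * node_prod iota (open_gf iota)
    (rep alpha) n.
Proof.
have frobI := @frob_inj k K iota N.
have frob_pgl a p : frob (pgl_act a p) = pgl_act a (frob p) :=
  pgl_iter_frob iota 1 a p.
have stab (t : {perm Om k K N n}) (g : Lin -> Lin)
  (tE : forall x, val (t x) = g (val x))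
    (gI : injective g) :=
  card_stable_nsets frobI gI (@frob_permE k K iota N n) tE
    (@periodic_Om k K iota N n).
apply: orbits_coef.
(* With the identity as second map, the fixed collections are all the stable ones, which yields
   finiteness. *)
- have [|fin _] := stab 1%g id _ (@inj_id _); first by move=> x; rewrite perm1.
  by apply: sub_finite_set fin => S H; split=> //; apply: fset_map_id.
- move=> S; apply/fsetP => p; apply/imfsetP/idP => [[x /= xS ->]|pS].
    by rewrite pgl_act1.
  by exists p; rewrite ?pgl_act1.
- move=> a b S; rewrite fset_map_comp; apply/fsetP => p.
  by apply/imfsetP/imfsetP => -[x /= xS ->]; exists x => //=; rewrite pgl_actM.
- move=> a S [Sp Sn FS]; split.
  + by move=> _ /imfsetP[p /= /Sp pp ->]; apply/pgl_pointsE.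
  + by rewrite card_imfset //; apply: pgl_act_inj.
  + rewrite -[in RHS]FS !fset_map_comp; apply/fsetP => p.
    by apply/imfsetP/imfsetP => -[x /= xS ->]; exists x => //=;
      rewrite frob_pgl.
- move=> g; have [_ ->] :=
    stab _ _ (@pgl_permE k K iota N n g) (@pgl_act_inj _ _ _ _ g).
  by apply: card_inv_node_prod => // h A m; apply: open_gf_coef.
- move=> g h; apply: (node_prod_iso K_alg (n := n) (P := leq^~ 1%N)) =>
    // g' A m.
  exact: open_gf_coef.
Qed.

Lemma num_morbits_coef :
  (num_morbits iota N n)%:R =
  \sum_(alpha in subtypes iota C) mass alpha * node_prod iota (open_mgf iota)
    (rep alpha) n.
Proof.
have frobI := @frob_inj k K iota N.
have frob_pgl a p : frob (pgl_act a p) = pgl_act a (frob p) :=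
  pgl_iter_frob iota 1 a p.
have stab (t : {perm Om k K N n}) (g : Lin -> Lin)
  (tE : forall x, val (t x) = g (val x))
    (gI : injective g) :=
  card_stable_nmsets frobI gI (@frob_permE k K iota N n) tE
    (@periodic_Om k K iota N n).
apply: orbits_coef.
- have [|fin _] := stab 1%g id _ (@inj_id _); first by move=> x; rewrite perm1.
  by apply: sub_finite_set fin => S H; split=> //; apply: mset_map_id.
- move=> S; rewrite /mset_map (eq_map (@pgl_act1 k K iota N)) map_id;
    exact: seq_mset_id.
- move=> a b S; rewrite mset_map_comp /mset_map.
  by rewrite (eq_map (@pgl_actM k K iota N a b)).
- move=> a S [Sp Sn FS]; split.
  + move=> p; rewrite (perm_mem (perm_eq_seq_mset _)) => /mapP[x /Sp xp ->].
    exact/pgl_pointsE.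
  + by rewrite (perm_size (perm_eq_seq_mset _)) size_map.
  + rewrite -[in RHS]FS !mset_map_comp /mset_map.
    by rewrite (@eq_map _ _ _ (pgl_act a \o frob)) // => p /=; rewrite frob_pgl.
- move=> g; have [_ ->] :=
    stab _ _ (@pgl_permE k K iota N n g) (@pgl_act_inj _ _ _ _ g).
  by apply: card_inv_node_prod => // h A m; apply: open_mgf_coef.
- move=> g h; apply: (node_prod_iso K_alg (n := n) (P := predT)) => // g' A m.
  exact: open_mgf_coef.
Qed.

End Main.

(* K is an algebraic closure of k through iota; C is a set of representatives *)
(* of the conjugacy classes; the element rep alpha at which the product over  *)
(* L(alpha) is computed is arbitrary in alpha.                                *)
Theorem theorem4p4 (k : finFieldType) (K : closedFieldType)
    (iota : {rmorphism k -> K}) (K_alg : forall x : K, algebraicOver iota x)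
    (N : nat) (N_gt0 : (0 < N)%N)
    (C : {set PGL k N})
    (C_repr : is_transversal C (classes [set: PGL k N]) [set: PGL k N])
    (rep : {set PGL k N} -> PGL k N)
    (rep_in : forall alpha, alpha \in subtypes iota C -> rep alpha \in alpha) :
  (forall n : nat, (num_orbits iota N n)%:R =
     \sum_(alpha in subtypes iota C)
        mass alpha * node_prod iota (open_gf iota) (rep alpha) n) /\
  (forall n : nat, (num_morbits iota N n)%:R =
     \sum_(alpha in subtypes iota C)
        mass alpha * node_prod iota (open_mgf iota) (rep alpha) n).
Proof.
by split=> n; [apply: num_orbits_coef | apply: num_morbits_coef].
Qed.
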